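(* The Neyman–Pearson problem for $\mathrm{AVaR}_\lambda$ with capital constraint $v$ has a unique solution $X^*$. If $v\le v_\lambda$, then $$X^*=\mathbb I_{[b_0,\infty)}(\varphi),\qquad b_0:=q_\varphi(z_v).$$ If $v>v_\lambda$, then the solution is given by $$X^*=\beta^*+(1-\beta^* )\mathbb I_{[b_1,\infty)}(\varphi),\qquad \beta^*=\frac{v-1+\Phi(y_\lambda)}{\Phi(y_\lambda)},\quad b_1=q_\varphi(y_\lambda).$$ Moreover, with $C_\lambda:=(y_\lambda+\lambda-1)/\Phi(y_\lambda)$, the minimal risk $R_\varphi(v)$ is given by $$R_\varphi(v)=\begin{cases}(1-z_v)/\lambda,&\text{if }v\le v_\lambda,\\ 1-C_\lambda(1-v)/\lambda,&\text{if }v>v_\lambda.\end{cases}$$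
   Context: $\lambda\in(0,1]$ and $v\in[0,1]$ are given. $(\Omega,\mathcal F,P)$ is an atomless probability space, and the price density $\varphi$ is a random variable with $\varphi>0$ $P$-a.s. and $E[\varphi]=1$. Its distribution function $F_\varphi$ under $P$ is assumed continuous and strictly increasing on $\{x>0\mid F_\varphi(x)<1\}$. $q_\varphi$ denotes the (continuous, strictly increasing) quantile function of $\varphi$, with $q_\varphi(0):=0$ and $q_\varphi(1):=\|\varphi\|_{L^\infty}\le\infty$. Uniqueness of solutions is understood up to $P$-a.s. equality. For $X\in L^\infty(\Omega,\mathcal F,P)$, $\mathrm{AVaR}_\lambda(-X)=\max_{Q\in\mathcal Q_\lambda}E_Q[X]=\frac1\lambda\int_{1-\lambda}^1q_X(t)\,dt$, where $\mathcal Q_\lambda$ is the set of probability measures $Q\ll P$ with $dQ/dP\le1/\lambda$ $P$-a.s. and $q_X$ is a quantile function of $X$. The Neyman–Pearson problem for $\mathrm{AVaR}_\lambda$ with capital constraint $v$ is (with upper bound normalized to $K=1$): minimize $\mathrm{AVaR}_\lambda(-X)$ over all random variables $X$ with $0\le X\le1$ and $E[\varphi X]\ge v$. Its minimal value is denoted $R_\varphi(v)$. $\Phi(x):=\int_0^xq_\varphi(t)\,dt$ for $0\le x\le1$; $z_v\in[0,1]$ is the unique number with $\Phi(z_v)=1-v$; $y_\lambda\in(1-\lambda,1]$ is defined as the unique maximizer of the function $(0,1]\ni y\mapsto(y+\lambda-1)/\Phi(y)$; and $v_\lambda:=1-\Phi(y_\lambda)$. *)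

(* Defs.v *)
From HB Require Import structures.
From mathcomp Require Import all_boot all_order all_algebra.
From mathcomp Require Import all_classical all_reals all_analysis.
Import Order.TTheory GRing.Theory Num.Theory.
Import numFieldNormedType.Exports.

Set Implicit Arguments.
Unset Strict Implicit.
Unset Printing Implicit Defensive.

Local Open Scope classical_set_scope.
Local Open Scope ring_scope.
Local Open Scope charge_scope.

Section NeymanPearson.
Context (d : measure_display) (T : measurableType d) (R : realType).
Variable P : probability T R.

Definition atomless : Prop :=
  forall A, measurable A -> (0 < P A)%E ->
  exists B, [/\ measurable B, B `<=` A, (0 < P B)%E & (P B < P A)%E].

Definition Q_set (lam : R) : set (probability T R) :=
  [set Q : probability T R | Q `<< P /\
    {ae P, forall w, (('d (charge_of_finite_measure Q) '/d P) w
                       <= (lam^-1)%:E)%E}].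

(* [Y] is a financial position (a gain), so that the risk of the liability
   [X] is [AVaR lam (\- X)], the supremum of [E_Q[X]]. *)
Definition AVaR (lam : R) (Y : T -> R) : \bar R :=
  ereal_sup [set 'E_Q[\- Y]%E | Q in Q_set lam].

Section price_density.
Variable phi : {RV P >-> R}.

(* Extended-valued, because [quantile 1] is infinite for unbounded [phi];
   only meaningful for [t] in [0, 1]. *)
Definition quantile (t : R) : \bar R :=
  if t == 0 then 0%E
  else if t == 1 then ('N[P]_+oo[EFin \o phi])%E
  else ereal_inf [set x%:E | x in [set x : R | (t%:E <= cdf phi x)%E]].

(* [Phi 1 = 'E_P[phi]] is finite, so [fine] loses nothing. *)
Definition Phi (x : R) : R :=
  fine (\int[lebesgue_measure]_(t in `[0%R, x]) quantile t)%E.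

Definition z_of (v : R) : R :=
  xget 0 [set z | z \in `[0, 1] /\ Phi z = 1 - v].

(* The unique maximizer of [(y + lam - 1) / Phi y] over (0, 1].  It exists for
   [lam < 1].  For [lam = 1] the function [y / Phi y] is strictly decreasing,
   hence has no maximizer on (0, 1]; the default value [0] of [xget] is then the
   limiting maximizer, and gives [v_lambda 1 = 1]. *)
Definition y_lambda (lam : R) : R :=
  xget 0 [set y | y \in `]1 - lam, 1] /\
    forall y', y' \in `]0, 1] -> y' != y ->
      (y' + lam - 1) / Phi y' < (y + lam - 1) / Phi y].

Definition v_lambda (lam : R) : R := 1 - Phi (y_lambda lam).

Definition C_lambda (lam : R) : R :=
  (y_lambda lam + lam - 1) / Phi (y_lambda lam).

Definition beta_star (lam v : R) : R :=
  (v - 1 + Phi (y_lambda lam)) / Phi (y_lambda lam).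

(* The indicator of [b, oo) evaluated at [phi]; [b] may be infinite. *)
Definition indic_ge (b : \bar R) : T -> R := \1_[set w | (b <= (phi w)%:E)%E].

(* As usual in L^oo, the bounds on [X] hold almost surely. *)
Definition admissible (v : R) : set (T -> R) :=
  [set X : T -> R | [/\ measurable_fun [set: T] X,
               {ae P, forall w, 0 <= X w <= 1}
             & (v%:E <= 'E_P[(phi : T -> R) \* X])%E]].

Definition NP_solution (lam v : R) (X : T -> R) : Prop :=
  admissible v X /\
  forall Y, admissible v Y -> (AVaR lam (\- X)%R <= AVaR lam (\- Y)%R)%E.

Definition NP_unique_solution (lam v : R) (X : T -> R) : Prop :=
  NP_solution lam v X /\
  forall Y, NP_solution lam v Y -> {ae P, forall w, Y w = X w}.

Definition min_risk (lam v : R) : \bar R :=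
  ereal_inf [set AVaR lam (\- X) | X in admissible v].

End price_density.
End NeymanPearson.

(* Main.v *)
Require Import Defs.
From HB Require Import structures.
From mathcomp Require Import all_boot all_order all_algebra.
From mathcomp Require Import all_classical all_reals all_analysis.
From mathcomp Require Import measurable_realfun ess_sup_inf ring lra.
Import Order.TTheory GRing.Theory Num.Theory.
Import numFieldNormedType.Exports.
Local Open Scope classical_set_scope.
Local Open Scope ring_scope.

Set Implicit Arguments.
Unset Strict Implicit.
Unset Printing Implicit Defensive.

(** The proof is a weak duality argument in which the optimal dual density is
    explicit.  For a multiplier [kap > 0] and [th] in [0, 1], put
      [g = 1 - th (1 - kap phi)^+],  with  [th E[(1 - kap phi)^+] = 1 - lam].
    Then [0 <= g <= 1] and [E[g] = lam], so that [g / lam] is the density of a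
    measure entering the average value at risk, and an admissible [X] satisfies
      [lam AVaR(-X) >= E[g X]
         = kap E[phi X] + (1 - th) E[(1 - kap phi)^+ X] - E[(kap phi - 1)^+ X]
         >= kap v - E[(kap phi - 1)^+]].

    If the extreme terms agree, then [E[phi X] = v], [X = 1] where
    [kap phi > 1], and, when [th < 1], [X = 0] where [kap phi < 1].  When
    [th > 0] one has [0 < g < 1] where [kap phi < 1], and [X] must be constant
    there: with [c] the mean of [X] weighted by [g (1 - g)], the function
    [g + g (1 - g) (X - c)] is again a competitor, and it increases [E[g X]] by
    [E[g (1 - g) (X - c)^2]] ([AVaR_maximizer_const]).  The constant is
    determined by [E[phi X] = v], whence uniqueness ([dual_certificate]).
    Conversely, [Q(A) <= P(A) / lam] bounds the risk of a position
    [b + (1 - b) 1_A] from above ([AVaR_two_level]), and it remains to choose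
    [kap] so that the two bounds agree.

    That choice rests on the convexity of [Phi].  The distribution function [F]
    of [phi] turns [phi] into a uniform variable, so that
    [Phi y = E[phi; F(phi) <= y]], and among all events those of the form
    [phi <= b] minimize [E[phi - b; A]]; hence [Phi] lies strictly above its
    tangent of slope [b] at [F b] ([Phi_tangent]).  Consequently a maximizer of
    [(y + lam - 1) / Phi y] with maximum [C] is [F (1 / C)], and it is unique.
    - If [v > v_lambda], take [kap = C_lambda] and [th = 1].
    - If [v <= v_lambda], take [kap = 1 / q(z_v)]; the required [th] lies in
      [0, 1] because [z_v >= y_lambda].  At the extreme levels [z_v = 0] and
      [z_v = 1] the quantile may be 0 or infinite; they occur only for [v = 1]
      (with [lam = 1]) and [v = 0], when the optimal position is almost surely
      constant for elementary reasons.
    For [lam = 1] the ratio has no maximizer, so that [y_lambda = 0] by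
    convention and every [v] falls under [v <= v_lambda = 1]. *)

(** * Expectations of real-valued functions *)

Section real_expectation.
Context (d : measure_display) (T : measurableType d) (R : realType).
Context (P : probability T R).
Implicit Types f g X Y : T -> R.

Notation L1 f := (P.-integrable setT (EFin \o f%R)).
Notation E f := (\int[P]_x f x)%R.

Lemma L1_measurable f : L1 f -> measurable_fun setT f.
Proof. by move=> /measurable_int /measurable_EFinP. Qed.

Lemma L1_dominated f g : measurable_fun setT f -> L1 g ->
  {ae P, forall x, `|f x| <= g x} -> L1 f.
Proof.
move=> mf /[dup] Lg /integrableP[mg gi] fg; apply/integrableP; split.
  exact/measurable_EFinP.
apply: le_lt_trans gi; apply: ae_ge0_le_integral => //.
- by apply: measurableT_comp => //; exact/measurable_EFinP.
- exact: measurableT_comp.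
- apply: filterS fg => x fgx _; rewrite /= lee_fin.
  by rewrite (le_trans fgx)// ler_norm.
Qed.

Lemma L1_cst r : L1 (fun=> r).
Proof. exact: finite_measure_integrable_cst. Qed.

Lemma L1_bounded f M : measurable_fun setT f ->
  {ae P, forall x, `|f x| <= M} -> L1 f.
Proof. by move=> mf fM; apply: L1_dominated (L1_cst M) _. Qed.

Lemma L1D f g : L1 f -> L1 g -> L1 (fun x => f x + g x).
Proof. by move=> fi gi; apply: (integrableD measurableT fi gi). Qed.

Lemma L1Z r f : L1 f -> L1 (fun x => r * f x).
Proof. by move=> fi; apply: (integrableZl measurableT r fi). Qed.

Lemma L1B f g : L1 f -> L1 g -> L1 (fun x => f x - g x).
Proof. by move=> fi gi; apply: (integrableB measurableT fi gi). Qed.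

Lemma L1M f X : L1 f -> measurable_fun setT X ->
  {ae P, forall x, `|X x| <= 1} -> L1 (fun x => f x * X x).
Proof.
move=> Lf mX X1; apply: (@L1_dominated _ (fun x => `|f x|)).
- by apply: measurable_funM => //; exact: L1_measurable.
- exact: (integrable_norm Lf).
- apply: filterS X1 => x Xx; rewrite normrM.
  by rewrite -[leRHS]mulr1 ler_wpM2l.
Qed.

Lemma ED f g : L1 f -> L1 g -> E (fun x => f x + g x) = E f + E g.
Proof. exact: RintegralD. Qed.

Lemma EB f g : L1 f -> L1 g -> E (fun x => f x - g x) = E f - E g.
Proof. exact: RintegralB. Qed.

Lemma EZ r f : L1 f -> E (fun x => r * f x) = r * E f.
Proof. exact: RintegralZl. Qed.

Lemma E_cst r : E (fun=> r) = r.
Proof.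
by rewrite Rintegral_cst// (congr1 fine (probability_setT P) : fine _ = 1) mulr1.
Qed.

Lemma EFin_E f : L1 f -> (E f)%:E = (\int[P]_x (f x)%:E)%E.
Proof. by move=> fi; rewrite /Rintegral fineK//; exact: integrable_fin_num. Qed.

Lemma E_ae f g : measurable_fun setT f -> measurable_fun setT g ->
  {ae P, forall x, f x = g x} -> E f = E g.
Proof.
move=> mf mg fg; congr fine; apply: ae_eq_integral => //.
- exact/measurable_EFinP.
- exact/measurable_EFinP.
- by apply: filterS fg => x /= ->.
Qed.

Lemma E_ge0 f : measurable_fun setT f ->
  {ae P, forall x, 0 <= f x} -> 0 <= E f.
Proof.
move=> mf f0; rewrite (@E_ae f (fun x => Num.max 0 (f x)))//.
- by apply: Rintegral_ge0 => x _; rewrite le_max lexx.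
- exact: measurable_maxr.
- by apply: filterS f0 => x f0; rewrite max_r.
Qed.

Lemma E_eq0 f : L1 f -> {ae P, forall x, 0 <= f x} -> E f <= 0 ->
  {ae P, forall x, f x = 0}.
Proof.
move=> Lf f0 Ef0.
have mf := L1_measurable Lf.
have Ef : E f = 0 by apply/eqP; rewrite eq_le Ef0 E_ge0.
have mfE : measurable_fun setT (EFin \o f) by exact/measurable_EFinP.
have : ae_eq P setT (EFin \o f) (cst 0%E).
  apply/(ae_eq_integral_abs P measurableT mfE).
  transitivity (\int[P]_x (f x)%:E)%E; last by rewrite -EFin_E// Ef.
  apply: ae_eq_integral => //; first exact: measurableT_comp.
  by apply: filterS f0 => x f0 _ /=; rewrite ger0_norm.
by apply: filterS => x /= /(_ I) [].
Qed.

Lemma E_le f g : L1 f -> L1 g ->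
  {ae P, forall x, f x <= g x} -> E f <= E g.
Proof.
move=> Lf Lg fg; rewrite -subr_ge0 -EB//; apply: E_ge0.
  exact/L1_measurable/L1B.
by apply: filterS fg => x; rewrite subr_ge0.
Qed.

Lemma L1_indic A : measurable A -> L1 (\1_A : T -> R).
Proof. exact: integrable_indic. Qed.

Lemma E_indic A : measurable A -> E (\1_A : T -> R) = fine (P A).
Proof. by move=> mA; rewrite /Rintegral integral_indic// setIT. Qed.

End real_expectation.

(** * Probabilities with a density *)

Section density_probability.
Context (d : measure_display) (T : measurableType d) (R : realType).
Context (P : probability T R) (f : T -> R).
Hypothesis mf : measurable_fun setT f.
Hypothesis f0 : forall x, 0 <= f x.
Hypothesis f1 : (\int[P]_x (f x)%:E = 1)%E.

(** The hypotheses are arguments of the definition so that it can carry the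
    structure of a probability. *)
Definition density_prob of measurable_fun setT f & (forall x, 0 <= f x)
    & (\int[P]_x (f x)%:E = 1)%E : set T -> \bar R :=
  fun A => (\int[P]_(x in A) (f x)%:E)%E.

Let Q := density_prob mf f0 f1.

Let Q0 : Q set0 = 0%E. Proof. by rewrite /Q/density_prob integral_set0. Qed.

Let Q_ge0 A : (0 <= Q A)%E.
Proof. by apply: integral_ge0 => x _; rewrite lee_fin. Qed.

Let Q_sigma_additive : semi_sigma_additive Q.
Proof.
apply: semi_sigma_additive_nng_induced; first exact/measurable_EFinP.
by move=> x; rewrite lee_fin.
Qed.

HB.instance Definition _ := isMeasure.Build _ _ _ Q Q0 Q_ge0 Q_sigma_additive.

HB.instance Definition _ := @Measure_isProbability.Build _ _ R Q f1.

Local Open Scope charge_scope.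

Lemma density_prob_dominated : Q `<< P.
Proof.
apply/null_content_dominatesP => A mA PA0.
apply: null_set_integral => //; apply/measurable_EFinP.
exact: measurable_funS mf.
Qed.

Lemma Radon_Nikodym_density :
  ae_eq P setT ('d (charge_of_finite_measure Q) '/d P) (EFin \o f).
Proof.
apply: integral_ae_eq => //.
- apply: Radon_Nikodym_integrable; exact: density_prob_dominated.
- exact/measurable_EFinP.
- move=> A _ mA; rewrite -Radon_Nikodym_integral//.
  exact: density_prob_dominated.
Qed.

Lemma integral_density_prob (X : T -> R) : measurable_fun setT X ->
  {ae P, forall x, `|X x| <= 1} ->
  (\int[Q]_x (X x)%:E = \int[P]_x (X x * f x)%:E)%E.
Proof.
move=> mX X1; have PQ := density_prob_dominated.
rewrite -(Radon_Nikodym_change_of_variables PQ)//; last first.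
  apply: (@L1_bounded _ _ _ _ _ 1) => //.
  case: X1 => N [mN PN0 sN]; exists N; split => //.
  by move/null_content_dominatesP : PQ; exact.
apply: ae_eq_integral => //.
- apply: emeasurable_funM; first exact/measurable_EFinP.
  exact/(measurable_int P)/Radon_Nikodym_integrable.
- by apply/measurable_EFinP; exact: measurable_funM.
- by apply: filterS Radon_Nikodym_density => x /(_ I) -> _.
Qed.

End density_probability.

(** * Bounds on the average value at risk *)

Section risk_bounds.
Context (d : measure_display) (T : measurableType d) (R : realType).
Context (P : probability T R).
Variables (lam : R) (lam_gt0 : 0 < lam).
Implicit Types g Y : T -> R.

Notation L1 f := (P.-integrable setT (EFin \o f%R)).
Notation E f := (\int[P]_x f x)%R.

Lemma ae_norm_le1 (X : T -> R) : {ae P, forall x, 0 <= X x <= 1} ->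
  {ae P, forall x, `|X x| <= 1}.
Proof. by apply: filterS => x /andP[X0 X1]; rewrite ger0_norm. Qed.

Lemma L1_unit (X : T -> R) : measurable_fun setT X ->
  {ae P, forall x, 0 <= X x <= 1} -> L1 X.
Proof.
by move=> mX X01; apply: (@L1_bounded _ _ _ _ _ 1) => //; exact: ae_norm_le1.
Qed.

(** Truncating [g] to [0, 1] everywhere makes [g / lam] a genuine density,
    without changing any integral. *)
Lemma AVaR_ge g Y : measurable_fun setT g -> measurable_fun setT Y ->
  {ae P, forall x, 0 <= g x <= 1} -> {ae P, forall x, 0 <= Y x <= 1} ->
  E g = lam -> ((E (fun x => g x * Y x) / lam)%:E <= AVaR P lam (\- Y)%R)%E.
Proof.
move=> mg mY g01 Y01 Eg.
have lam0 : lam != 0 by rewrite gt_eqF.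
pose f x := lam^-1 * Num.max 0 (Num.min 1 (g x)).
have mf : measurable_fun setT f.
  by apply: measurable_funM => //; apply: measurable_maxr => //; exact: measurable_minr.
have f0 x : 0 <= f x.
  by rewrite mulr_ge0 ?invr_ge0 ?(ltW lam_gt0)// le_max lexx.
have fl x : f x <= lam^-1.
  rewrite -[leRHS]mulr1 ler_wpM2l// ?invr_ge0 ?(ltW lam_gt0)//.
  by rewrite ge_max ler01/= ge_min lexx.
have fg : {ae P, forall x, f x = lam^-1 * g x}.
  apply: filterS g01 => x /andP[g0 g1].
  by rewrite /f min_r// max_r.
have Lg : L1 g by exact: L1_unit.
have Lf : L1 f.
  apply: (@L1_bounded _ _ _ _ _ lam^-1) => //.
  by apply: nearW => x; rewrite ger0_norm.
have Ef : E f = 1.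
  rewrite (E_ae mf _ fg); last by apply: measurable_funM.
  by rewrite EZ// Eg mulVf.
have f1 : (\int[P]_x (f x)%:E = 1)%E by rewrite -EFin_E// Ef.
apply: ereal_sup_ubound; exists (density_prob mf f0 f1).
  split; first exact: density_prob_dominated.
  apply: filterS (Radon_Nikodym_density mf f0 f1) => x /(_ I) ->.
  by rewrite lee_fin.
rewrite unlock.
transitivity (\int[density_prob mf f0 f1]_x (Y x)%:E)%E.
  by apply: eq_integral => x _ /=; rewrite opprK.
rewrite integral_density_prob//; last exact: ae_norm_le1.
transitivity (\int[P]_x ((lam^-1 * (g x * Y x))%R)%:E)%E.
  apply: ae_eq_integral => //.
  - by apply/measurable_EFinP; exact: measurable_funM.
  - apply/measurable_EFinP; apply: measurable_funM => //.
    exact: measurable_funM.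
  - by apply: filterS fg => x -> _; rewrite mulrC mulrA.
have LgY : L1 (fun x => g x * Y x) by apply: L1M => //; exact: ae_norm_le1.
by rewrite -EFin_E ?L1Z// EZ// mulrC.
Qed.

(** First-order condition for a maximizing density [g]: mass may be moved in
    both directions where [0 < g < 1].  With [m = g (1 - g)] and [c] the
    [m]-weighted mean of [Y], the perturbation [m (Y - c)] has mean zero, keeps
    [g] between 0 and 1, and raises [E[g Y]] by [E[m (Y - c)^2]]. *)
Lemma AVaR_maximizer_const g Y :
  measurable_fun setT g -> measurable_fun setT Y ->
  {ae P, forall x, 0 <= g x <= 1} -> {ae P, forall x, 0 <= Y x <= 1} ->
  E g = lam -> (AVaR P lam (\- Y)%R <= (E (fun x => g x * Y x) / lam)%:E)%E ->
  exists c, {ae P, forall x, 0 < g x < 1 -> Y x = c}.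
Proof.
move=> mg mY g01 Y01 Eg AY.
pose m x := g x * (1 - g x).
have mm : measurable_fun setT m.
  by apply: measurable_funM => //; exact: measurable_funB.
have m01 : {ae P, forall x, 0 <= m x <= 1}.
  by apply: filterS g01 => x /andP[g0 g1]; apply/andP; rewrite /m; split; nra.
have Lm : L1 m by exact: L1_unit.
have mmY : measurable_fun setT (fun x => m x * Y x) by exact: measurable_funM.
have LmY : L1 (fun x => m x * Y x) by apply: L1M => //; exact: ae_norm_le1.
have LmYY : L1 (fun x => m x * Y x * Y x) by apply: L1M => //; exact: ae_norm_le1.
have LgY : L1 (fun x => g x * Y x).
  by apply: L1M => //; [exact: L1_unit|exact: ae_norm_le1].
have mY0 : 0 <= E (fun x => m x * Y x).
  apply: E_ge0 => //.
  by apply: filterS2 m01 Y01 => x /andP[m0 _] /andP[Y0 _]; exact: mulr_ge0.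
have mYm : E (fun x => m x * Y x) <= E m.
  apply: E_le => //.
  by apply: filterS2 m01 Y01 => x /andP[m0 _] /andP[Y0 Y1]; rewrite ler_piMr.
pose c := E (fun x => m x * Y x) / E m.
have cE : c * E m = E (fun x => m x * Y x).
  (* if [E m = 0] then [c = 0] by convention and [E[m Y] <= E m] vanishes too *)
  rewrite /c; have [Em0|Em0] := eqVneq (E m) 0; last by rewrite divfK.
  by apply/eqP; rewrite Em0 mulr0 eq_sym eq_le mY0 andbT -Em0.
have c01 : 0 <= c <= 1.
  have Em0 : 0 <= E m by exact: le_trans mYm.
  rewrite /c divr_ge0//=; have [->|Emn0] := eqVneq (E m) 0.
    by rewrite invr0 mulr0.
  by rewrite ler_pdivrMr ?mul1r// lt_neqAle eq_sym Emn0.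
exists c.
pose h x := m x * Y x - c * m x.
have Lh : L1 h by apply: L1B => //; exact: L1Z.
have Lg : L1 g by exact: L1_unit.
pose g' x := g x + h x.
have Eg' : E g' = lam.
  by rewrite ED// Eg EB//; [rewrite EZ// cE subrr addr0|exact: L1Z].
have g'01 : {ae P, forall x, 0 <= g' x <= 1}.
  apply: filterS2 g01 Y01 => x /andP[g0 g1] /andP[Y0 Y1].
  have /andP[c0 c1] := c01.
  have -> : g' x = g x + g x * (1 - g x) * (Y x - c) by rewrite /g' /h /m; ring.
  have [s0 s1] : g x * (1 - g x) <= g x /\ g x * (1 - g x) <= 1 - g x by split; nra.
  have m0 : 0 <= g x * (1 - g x) by nra.
  by apply/andP; split; nra.
have mg' : measurable_fun setT g' by exact: L1_measurable (L1D Lg Lh).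
have := AVaR_ge mg' mY g'01 Y01 Eg'.
move=> /le_trans /(_ AY); rewrite lee_fin ler_pM2r ?invr_gt0//.
have Lmc : L1 (fun x => c * (m x * Y x)) by exact: L1Z.
have Lmcc : L1 (fun x => c * (c * m x)) by do 2 apply: L1Z.
pose q x := (m x * Y x * Y x - c * (m x * Y x)) -
  (c * (m x * Y x) - c * (c * m x)).
have Lq : L1 q by apply: L1B; apply: L1B.
have qE x : q x = m x * (Y x - c) ^+ 2 by rewrite /q; ring.
have -> : E (fun x => g' x * Y x) = E (fun x => g x * Y x) + E q.
  rewrite /q EB; [|exact: L1B..].
  rewrite [X in _ - X]EB// (EZ _ LmY) EZ; last exact: L1Z.
  rewrite EZ// cE subrr subr0 -ED//; last exact: L1B.
  by apply: eq_Rintegral => x _; rewrite /g' /h; ring.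
rewrite gerDl => Eq0.
have q0 : {ae P, forall x, 0 <= q x}.
  apply: filterS m01 => x /andP[m0 _].
  by rewrite qE mulr_ge0// sqr_ge0.
apply: filterS (E_eq0 Lq q0 Eq0) => x; rewrite qE => /eqP.
rewrite mulf_eq0 sqrf_eq0 subr_eq0 => /orP[|/eqP//].
rewrite /m mulf_eq0 subr_eq0 => /orP[] /eqP gx.
  by rewrite gx ltxx.
by rewrite -gx ltxx andbF.
Qed.

Lemma Q_set_le (Q : probability T R) A : Q_set P lam Q -> measurable A ->
  fine (Q A) <= fine (P A) / lam.
Proof.
move=> [QP Ql] mA.
have mP B : measurable B -> P B \is a fin_num by move=> ?; exact: fin_num_measure.
rewrite -lee_fin EFinM !fineK ?fin_num_measure ?mP//.
have -> : Q A = charge_of_finite_measure Q A by [].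
rewrite (Radon_Nikodym_integral (nu := charge_of_finite_measure Q) QP mA).
have Ir := integrableS measurableT mA (@subsetT _ A)
  (Radon_Nikodym_integrable (nu := charge_of_finite_measure Q) QP).
case: Ql => N [mN PN0 sN].
rewrite (negligible_integral mN mA Ir PN0).
have mAN : measurable (A `\` N) by exact: measurableD.
apply: (@le_trans _ _ (\int[P]_(x in A `\` N) (lam^-1)%:E)%E).
  apply: le_integral => //.
  - by apply: integrableS Ir => //; exact: subDsetl.
  - exact: finite_measure_integrable_cst.
  - move=> x; rewrite inE => -[Ax Nx].
    by apply: contrapT => xl; apply: Nx; exact: sN.
rewrite integral_cst// muleC lee_wpmul2r ?lee_fin ?invr_ge0 ?(ltW lam_gt0)//.
by rewrite le_measure ?inE//; exact: subDsetl.
Qed.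

(** The supremum is at most the value at the largest conceivable mass
    [P(A) / lam] that a measure of the family gives to [A]. *)
Lemma AVaR_two_level A (b : R) : measurable A -> 0 <= b <= 1 ->
  (AVaR P lam (\- (fun x => b + (1 - b) * \1_A x))%R <=
   (b + (1 - b) * (fine (P A) / lam))%:E)%E.
Proof.
move=> mA /andP[b0 b1]; apply: ge_ereal_sup => _ [Q Qlam <-].
rewrite unlock.
have L : Q.-integrable setT (EFin \o (\1_A : T -> R)) by exact: L1_indic.
rewrite (_ : (\int[Q]_w _)%E = (b + (1 - b) * fine (Q A))%:E).
  rewrite lee_fin lerD2l ler_wpM2l ?subr_ge0//.
  exact: Q_set_le.
rewrite -(E_indic Q mA) -(EZ _ L) -[X in (X + _)%:E](E_cst Q) -ED; last 2 first.
- exact: L1_cst.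
- exact: L1Z.
rewrite EFin_E; last by apply: L1D; [exact: L1_cst|exact: L1Z].
by apply: eq_integral => x _ /=; rewrite opprK.
Qed.

End risk_bounds.

(** * Duality *)

Section duality.
Context (d : measure_display) (T : measurableType d) (R : realType).
Context (P : probability T R) (phi : {RV P >-> R}) (lam v : R).
Implicit Types X Y : T -> R.

Notation L1 f := (P.-integrable setT (EFin \o f%R)).
Notation E f := (\int[P]_x f x)%R.

Hypothesis lam_gt0 : 0 < lam.
Hypothesis L1phi : L1 phi.
Hypothesis phi_gt0 : {ae P, forall w, 0 < phi w}.

Lemma L1_phiM (Y : T -> R) : measurable_fun setT Y ->
  {ae P, forall w, 0 <= Y w <= 1} -> L1 (fun w => phi w * Y w).
Proof. by move=> mY Y01; apply: L1M => //; exact: ae_norm_le1. Qed.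

Lemma admissibleP (Y : T -> R) : admissible phi v Y <->
  [/\ measurable_fun setT Y, {ae P, forall w, 0 <= Y w <= 1}
    & v <= E (fun w => phi w * Y w)].
Proof.
rewrite /admissible /= unlock.
by split=> -[mY Y01 vY]; split => //; move: vY; rewrite -lee_fin EFin_E//;
  exact: L1_phiM.
Qed.

(** Attaining a lower bound that only almost sure modifications of [X] attain
    settles existence, uniqueness and the value at once. *)
Lemma lower_bound_certificate X (B : \bar R) : admissible phi v X ->
  (AVaR P lam (\- X)%R <= B)%E ->
  (forall Y, admissible phi v Y -> (B <= AVaR P lam (\- Y)%R)%E) ->
  (forall Y, admissible phi v Y -> (AVaR P lam (\- Y)%R <= B)%E ->
    {ae P, forall w, Y w = X w}) ->
  NP_unique_solution phi lam v X /\ min_risk phi lam v = B.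
Proof.
move=> aX AX lbB uX.
have AXE : AVaR P lam (\- X)%R = B by apply/eqP; rewrite eq_le AX lbB.
split; last first.
  apply/eqP; rewrite eq_le; apply/andP; split.
    by rewrite -AXE; apply: ereal_inf_lbound; exists X.
  by apply: le_ereal_inf_tmp => _ [Y aY <-]; exact: lbB.
split; first by split=> // Y aY; rewrite AXE; exact: lbB.
by move=> Y [aY Ymin]; apply: uX => //; rewrite -AXE; exact: Ymin.
Qed.

(** A multiplier [kap] for the capital constraint, with the weight [th] that
    normalizes the dual density [1 - th (1 - kap phi)^+]. *)
Section multiplier.
Variables kap th : R.
Hypothesis kap_gt0 : 0 < kap.
Hypothesis th01 : 0 <= th <= 1.
Hypothesis th_norm : th * E (fun w => Num.max 0 (1 - kap * phi w)) = 1 - lam.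

Definition dual_value :=
  (kap * v - E (fun w => Num.max 0 (kap * phi w - 1))) / lam.

Let p w := Num.max 0 (1 - kap * phi w).
Let n w := Num.max 0 (kap * phi w - 1).
Let g w := 1 - th * p w.

Let dual_valueE : dual_value = (kap * v - E n) / lam.
Proof. by []. Qed.

Let mkphi : measurable_fun setT (fun w => kap * phi w).
Proof. exact: measurable_funM. Qed.

Let mp : measurable_fun setT p.
Proof. by apply: measurable_maxr => //; exact: measurable_funB. Qed.

Let mn : measurable_fun setT n.
Proof. by apply: measurable_maxr => //; exact: measurable_funB. Qed.

Let mg : measurable_fun setT g.
Proof. by apply: measurable_funB => //; exact: measurable_funM. Qed.

Let p01 : {ae P, forall w, 0 <= p w <= 1}.
Proof.
apply: filterS phi_gt0 => w w0; rewrite /p le_max lexx/= ge_max ler01/=.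
by rewrite gerBl mulr_ge0// ltW.
Qed.

Let Lp : L1 p. Proof. exact: L1_unit. Qed.

Let Ln : L1 n.
Proof.
apply: (L1_dominated mn (L1Z kap L1phi)).
apply: filterS phi_gt0 => w w0; have k0 : 0 <= kap * phi w by rewrite mulr_ge0// ltW.
by rewrite /n ger0_norm ?le_max ?lexx// ge_max k0/= gerBl.
Qed.

Let g01 : {ae P, forall w, 0 <= g w <= 1}.
Proof.
apply: filterS p01 => w /andP[p0 p1]; have /andP[t0 t1] := th01.
by rewrite /g subr_ge0 mulr_ile1//= gerBl mulr_ge0.
Qed.

Let Eg : E g = lam.
Proof.
rewrite /g EB; [|exact: L1_cst|exact: L1Z].
by rewrite E_cst EZ// th_norm; ring.
Qed.

(** The nonnegative gap between [E[g Y]] and its lower bound when the capital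
    constraint is tight. *)
Let r Y w := (1 - th) * (p w * Y w) + (n w - n w * Y w).

Let EgY Y : measurable_fun setT Y -> {ae P, forall w, 0 <= Y w <= 1} ->
  L1 (r Y) /\
  E (fun w => g w * Y w) = kap * E (fun w => phi w * Y w) - E n + E (r Y).
Proof.
move=> mY Y01; have Y1 := ae_norm_le1 Y01.
have LpY := L1M Lp mY Y1; have LnY := L1M Ln mY Y1.
have LrY : L1 (r Y) by apply: L1D; [exact: L1Z|exact: L1B].
split=> //.
have LfY := L1_phiM mY Y01.
rewrite -EZ// -EB//; last exact: L1Z.
rewrite -ED//; last by apply: L1B => //; exact: L1Z.
apply: eq_Rintegral => w _; rewrite /g /r.
have -> : p w = n w + (1 - kap * phi w).
  rewrite /p /n; have [h|h] := leP (kap * phi w) 1.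
    by rewrite max_r ?max_l; lra.
  by rewrite max_l ?max_r; lra.
ring.
Qed.

Let r_ge0 Y : {ae P, forall w, 0 <= Y w <= 1} -> {ae P, forall w, 0 <= r Y w}.
Proof.
move=> Y01; apply: filterS2 p01 Y01 => w /andP[p0 _] /andP[Y0 Y1].
have n0 : 0 <= n w by rewrite le_max lexx.
have /andP[_ t1] := th01.
by rewrite /r addr_ge0// ?mulr_ge0// ?subr_ge0// ler_piMr.
Qed.

Lemma dual_value_le Y : admissible phi v Y ->
  ((dual_value)%:E <= AVaR P lam (\- Y)%R)%E.
Proof.
move=> /admissibleP[mY Y01 vY].
apply: le_trans (AVaR_ge lam_gt0 mg mY g01 Y01 Eg).
have [Lr ->] := EgY mY Y01.
have r0 := E_ge0 (L1_measurable Lr) (r_ge0 Y01).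
have kv : 0 <= kap * (E (fun w => phi w * Y w) - v).
  by rewrite mulr_ge0 ?(ltW kap_gt0)// subr_ge0.
rewrite dual_valueE lee_fin ler_pM2r ?invr_gt0//; lra.
Qed.

(** Vanishing of the gap gives [Y = 1] where [kap phi > 1].  Where
    [kap phi < 1], it gives [Y = 0] if [th = 0]; otherwise [0 < g < 1] there and
    the first-order condition makes [Y] constant. *)
Lemma dual_optimal_shape Y : admissible phi v Y ->
  (AVaR P lam (\- Y)%R <= (dual_value)%:E)%E ->
  E (fun w => phi w * Y w) = v /\
  exists c, {ae P, forall w, kap * phi w != 1 ->
                    Y w = if kap * phi w < 1 then c else 1}.
Proof.
move=> /admissibleP[mY Y01 vY] AY.
have [Lr EgYr] := EgY mY Y01.
have := le_trans (AVaR_ge lam_gt0 mg mY g01 Y01 Eg) AY.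
rewrite dual_valueE lee_fin ler_pM2r ?invr_gt0// EgYr => EgY_le.
have r0 := E_ge0 (L1_measurable Lr) (r_ge0 Y01).
have kv : 0 <= kap * (E (fun w => phi w * Y w) - v).
  by rewrite mulr_ge0 ?(ltW kap_gt0)// subr_ge0.
have Er0 : E (r Y) <= 0 by lra.
have /eqP : kap * (E (fun w => phi w * Y w) - v) = 0 by lra.
rewrite mulf_eq0 gt_eqF//= subr_eq0 => /eqP Ev.
split=> //.
have rY0 := E_eq0 Lr (r_ge0 Y01) Er0.
have [c Yc] : exists c, {ae P, forall w, kap * phi w < 1 -> Y w = c}.
  have /andP[t0 t1] := th01.
  have [th0|thn0] := eqVneq th 0.
    exists 0; near=> w => w1.
    have /andP[Y0 Y1] : 0 <= Y w <= 1 by near: w.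
    have : r Y w = 0 by near: w.
    rewrite /r th0 /n /p max_r ?max_l; [|lra|lra].
    rewrite mul0r subrr addr0 subr0 mul1r => /eqP.
    by rewrite mulf_eq0 => /orP[/eqP|/eqP//]; lra.
  have thp : 0 < th by rewrite lt_neqAle eq_sym thn0.
  have AgY : (AVaR P lam (\- Y)%R <= (E (fun w => (g w * Y w)%R) / lam)%:E)%E.
    apply: (le_trans AY); rewrite dual_valueE lee_fin ler_pM2r ?invr_gt0//.
    rewrite EgYr Ev; lra.
  have [c Yc] := AVaR_maximizer_const lam_gt0 mg mY g01 Y01 Eg AgY.
  exists c; near=> w => w1.
  have w0 : 0 < phi w by near: w.
  have Ywc : 0 < g w < 1 -> Y w = c by near: w.
  apply: Ywc; rewrite /g /p max_r; last lra.
  have k0 : 0 < kap * phi w by exact: mulr_gt0.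
  by apply/andP; split; nra.
exists c; near=> w => w1.
have Yw : kap * phi w < 1 -> Y w = c by near: w.
case: ltP => // w1'.
have {}w1 : 1 < kap * phi w by rewrite lt_neqAle eq_sym w1.
have : r Y w = 0 by near: w.
rewrite /r /n /p max_l ?max_r; [|lra|lra].
rewrite mul0r mulr0 add0r -[X in X - _]mulr1 -mulrBr => /eqP.
by rewrite mulf_eq0 => /orP[] /eqP; lra.
Unshelve. all: by end_near. Qed.

Hypothesis phi_no_atom : {ae P, forall w, kap * phi w != 1}.

(** Two optimal positions can differ only by a constant on [kap phi < 1]; both
    cost exactly [v] and [phi > 0], so either the constants agree or that event
    is negligible. *)
Lemma dual_certificate X : admissible phi v X ->
  (AVaR P lam (\- X)%R <= (dual_value)%:E)%E ->
  NP_unique_solution phi lam v X /\ min_risk phi lam v = (dual_value)%:E.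
Proof.
move=> aX AX; apply: lower_bound_certificate => //.
  exact: dual_value_le.
move=> Y aY AY.
have [EY [c Yc]] := dual_optimal_shape aY AY.
have [EX [c' Xc]] := dual_optimal_shape aX AX.
have /admissibleP[mY Y01 _] := aY.
have /admissibleP[mX X01 _] := aX.
pose A := [set w | kap * phi w < 1].
have mA : measurable A.
  by rewrite -[A]setTI; apply: (measurable_fun_ltr mkphi) => //; exact: measurable_cst.
have indA w : \1_A w = (if kap * phi w < 1 then 1 else 0) :> R.
  rewrite indicE; case: ifPn => w1; first by rewrite mem_set.
  by rewrite memNset//; exact/negP.
have LA : L1 (fun w => phi w * \1_A w).
  apply: L1_phiM => //; apply: nearW => w.
  by rewrite indicE ler0n lern1 leq_b1.
have : (c - c') * E (fun w => phi w * \1_A w) = 0.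
  transitivity (E (fun w => phi w * Y w) - E (fun w => phi w * X w)).
    rewrite -EZ// -EB; [|exact: L1_phiM..].
    apply: E_ae.
    - exact: L1_measurable (L1Z _ LA).
    - by apply: L1_measurable; apply: L1B; exact: L1_phiM.
    - apply: filterS3 phi_no_atom Yc Xc => w w1 /(_ w1) -> /(_ w1) ->.
      by rewrite indA; case: (kap * phi w < 1); ring.
  by rewrite EY EX subrr.
move=> /eqP; rewrite mulf_eq0 subr_eq0 => /orP[/eqP cc|/eqP EA].
  apply: filterS3 phi_no_atom Yc Xc => w w1 /(_ w1) -> /(_ w1) ->.
  by rewrite cc.
have A0 : {ae P, forall w, phi w * \1_A w = 0}.
  apply: E_eq0 => //; last by rewrite EA.
  by apply: filterS phi_gt0 => w w0; rewrite mulr_ge0 ?(ltW w0).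
near=> w.
have w1 : kap * phi w != 1 by near: w.
have -> : Y w = if kap * phi w < 1 then c else 1 by move: w1; near: w.
have -> : X w = if kap * phi w < 1 then c' else 1 by move: w1; near: w.
have : phi w * \1_A w = 0 by near: w.
have : 0 < phi w by near: w.
rewrite indA; case: (kap * phi w < 1) => //= w0 /eqP.
by rewrite mulr1 gt_eqF.
Unshelve. all: by end_near. Qed.

End multiplier.
End duality.

(** * Distribution and quantile function of the price density *)

Section price_quantile.
Context (d : measure_display) (T : measurableType d) (R : realType).
Context (P : probability T R) (phi : {RV P >-> R}).

Notation L1 f := (P.-integrable setT (EFin \o f%R)).
Notation E f := (\int[P]_x f x)%R.
Notation mu := (@lebesgue_measure R).

Hypothesis phi_gt0 : {ae P, forall w, 0 < phi w}.
Hypothesis phi_mean : ('E_P[phi] = 1)%E.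
Hypothesis cdf_cont : continuous (cdf phi).
Hypothesis cdf_incr : forall x y : R, 0 < x -> x < y -> (cdf phi y < 1)%E ->
  (cdf phi x < cdf phi y)%E.

Definition rcdf (b : R) : R := fine (cdf phi b).
Notation F := rcdf.

Lemma EFin_rcdf b : (F b)%:E = cdf phi b.
Proof. by rewrite fineK// fin_num_measure. Qed.

Lemma measurable_phi_le b : measurable [set w | phi w <= b].
Proof. by rewrite -[X in measurable X]setTI; apply: measurable_fun_ler. Qed.

Lemma rcdfE b : F b = fine (P [set w | phi w <= b]).
Proof.
by congr (fine (P _)); apply/seteqP; split => w /=; rewrite in_itv.
Qed.

Lemma P_phi_le b : P [set w | phi w <= b] = (F b)%:E.
Proof. by rewrite rcdfE fineK// fin_num_measure//; exact: measurable_phi_le. Qed.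

Lemma P_phi_gt b : P [set w | b < phi w] = (1 - F b)%:E.
Proof.
have -> : [set w | b < phi w] = ~` [set w | phi w <= b].
  by apply/seteqP; split => w /=; [move=> h; apply/negP|move/negP]; rewrite -ltNge.
by rewrite probability_setC ?P_phi_le//; exact: measurable_phi_le.
Qed.

Lemma rcdf_ge0 b : 0 <= F b.
Proof. by rewrite fine_ge0. Qed.

Lemma rcdf_le1 b : F b <= 1.
Proof. by rewrite -lee_fin EFin_rcdf cdf_le1. Qed.

Lemma rcdf_nd : {homo F : x y / x <= y}.
Proof. by move=> x y xy; rewrite -lee_fin !EFin_rcdf cdf_nondecreasing. Qed.

Lemma rcdf_cont : continuous F.
Proof.
move=> x; apply: fine_cvg; rewrite fineK ?fin_num_measure//.
exact: cdf_cont.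
Qed.

Lemma rcdf0 : F 0 = 0.
Proof.
rewrite rcdfE (_ : P _ = 0%E)//.
have [N [mN PN0 sN]] := phi_gt0.
apply: (subset_measure0 _ mN _ PN0) => //; first exact: measurable_phi_le.
by move=> w /= w0; apply: sN => /=; apply/negP; rewrite -leNgt.
Qed.

(** The assumed strict monotonicity concerns positive arguments and values
    below 1; it extends to the left endpoint 0 and to the value 1. *)
Lemma rcdf_lt x y : 0 <= x -> x < y -> F x < 1 -> F x < F y.
Proof.
move=> x0 xy Fx1.
have [Fy1|] := ltP (F y) 1; last by move=> h; exact: lt_le_trans h.
have cdfy1 : (cdf phi y < 1)%E by rewrite -EFin_rcdf lte_fin.
move: x0; rewrite le_eqVlt => /orP[/eqP x0|x0]; last first.
  by rewrite -lte_fin !EFin_rcdf cdf_incr.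
subst x; rewrite rcdf0 (le_lt_trans (rcdf_ge0 (y / 2)))//.
by rewrite -lte_fin !EFin_rcdf cdf_incr// ?divr_gt0// ltr_pdivrMr// ltr_pMr// ltr1n.
Qed.

Lemma rcdf_surj t : 0 <= t < 1 -> exists2 b, 0 <= b & F b = t.
Proof.
move=> /andP[t0 t1].
have [b b0 Fb] : exists2 b, 0 <= b & t <= F b.
  have /fine_cvgP[_ Fy1] := cvg_cdfy1 phi.
  have : \forall b \near +oo, t <= F b.
    exact: (cvgr_ge 1 Fy1).
  move=> H; near +oo_R => b; exists b; near: b; last exact: H.
  exact: nbhs_pinfty_ge (num_real _).
have [|c + Fc] := @IVT R F 0 b t b0 (continuous_subspaceT rcdf_cont).
  by rewrite rcdf0 min_l ?rcdf_ge0// max_r ?rcdf_ge0// t0.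
by rewrite in_itv/= => /andP[c0 _]; exists c.
Unshelve. all: by end_near. Qed.

(** Continuity of the distribution function excludes atoms. *)
Lemma phi_neq b : {ae P, forall w, phi w != b}.
Proof.
have mb : measurable [set w | phi w = b].
  exact: (measurable_funPTI phi (measurable_set1 b)).
exists [set w | phi w = b]; split => //; last first.
  by move=> w /= /negP; rewrite negbK => /eqP.
apply/eqP; rewrite eq_le measure_ge0 andbT.
apply/lee_addgt0Pr => e e0; rewrite add0e.
have [x xb Fx] : exists2 x, x < b & F b - e < F x.
  have H : \forall x \near b, F b - e < F x.
    have Fcb : F x @[x --> b] --> F b by exact: rcdf_cont.
    by apply: (cvgr_gt (F b) Fcb); rewrite ltrBlDr ltrDl.
  near b^'- => x; exists x; near: x; first exact: nbhs_left_lt.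
  by apply: (cvg_at_left_filter (f := id)) H; exact: cvg_id.
apply: (@le_trans _ _ (P ([set w | phi w <= b] `\` [set w | phi w <= x]))).
  rewrite le_measure ?inE//.
    by apply: measurableD; exact: measurable_phi_le.
  move=> w /= ->; split => //.
  by apply/negP; rewrite -ltNge.
rewrite measureD ?ltey_eq ?fin_num_measure//; [|exact: measurable_phi_le..].
rewrite setIidr; last by move=> w /= /le_trans; apply; exact: ltW.
apply: (@le_trans _ _ ((F b)%:E - (F x)%:E)%E); first by rewrite -!P_phi_le.
by rewrite -EFinB lee_fin; lra.
Unshelve. all: by end_near. Qed.

Lemma quantile_rcdf b : 0 < b -> F b < 1 -> quantile phi (F b) = b%:E.
Proof.
move=> b0 Fb1.
have Fb0 : 0 < F b by rewrite -rcdf0 rcdf_lt// rcdf0.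
rewrite /quantile gt_eqF// lt_eqF//.
apply/eqP; rewrite eq_le; apply/andP; split.
  by apply: ereal_inf_lbound; exists b => //=; rewrite EFin_rcdf.
apply: le_ereal_inf_tmp => _ [x /= Fbx <-].
rewrite lee_fin leNgt; apply/negP => xb.
move: Fbx; rewrite -EFin_rcdf lee_fin leNgt => /negP; apply.
have [x0|x0] := leP 0 x.
  by apply: rcdf_lt => //; apply: le_lt_trans (rcdf_nd (ltW xb)) _.
by apply: le_lt_trans (rcdf_nd (ltW x0)) _; rewrite rcdf0.
Qed.

Lemma rcdf_surj_gt0 t : 0 < t < 1 -> exists2 b, 0 < b & F b = t.
Proof.
move=> /andP[t0 t1].
have [|b b0 Fb] := @rcdf_surj t; first by rewrite (ltW t0).
exists b => //; rewrite lt_neqAle b0 andbT; apply/eqP => b0'.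
by move: t0; rewrite -Fb -b0' rcdf0 ltxx.
Qed.

(** The rank of [phi], its probability integral transform.  The target is the
    copy of the reals on which the uniform probability lives. *)
Definition U (w : T) : measurableTypeR R := F (phi w).

Lemma measurable_U : measurable_fun setT U.
Proof.
apply: (measurableT_comp (f := F)) => //.
by apply: nondecreasing_measurable => // x y; exact: rcdf_nd.
Qed.

HB.instance Definition _ := isMeasurableFun.Build _ _ _ _ U measurable_U.

Lemma rcdf_gtE b x : 0 <= b -> F b < 1 -> (F b < F x) = (b < x).
Proof.
move=> b0 Fb1; apply/idP/idP => [Fbx|bx]; last exact: rcdf_lt.
by rewrite ltNge; apply/negP => /rcdf_nd; rewrite leNgt Fbx.
Qed.

Lemma P_U_gt x : P [set w | x < U w] = (Num.min 1 (Num.max 0 (1 - x)))%:E.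
Proof.
have [x0|x0] := ltP x 0.
  rewrite min_l; last by rewrite le_max; apply/orP; right; lra.
  rewrite (_ : [set w | _] = setT) ?probability_setT//.
  by apply/seteqP; split=> w //= _; exact: lt_le_trans (rcdf_ge0 _).
have [x1|x1] := leP 1 x.
  rewrite max_l ?min_r; [|lra..].
  rewrite (_ : [set w | _] = set0) ?measure0//.
  by apply/seteqP; split=> w //=; rewrite ltNge (le_trans (rcdf_le1 _)).
rewrite max_r ?min_r; [|lra..].
have [|b b0 Fb] := @rcdf_surj x; first by rewrite x0.
rewrite -Fb -P_phi_gt; congr (P _); apply/seteqP; split => w /=;
  by rewrite /U rcdf_gtE// Fb.
Qed.

Lemma uniform_prob_gt x :
  uniform_prob (@ltr01 R) `]x, +oo[ = (Num.min 1 (Num.max 0 (1 - x)))%:E.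
Proof.
rewrite /uniform_prob integral_uniform_pdf.
have -> : (\int[mu]_(t in `]x, +oo[ `&` `[0%R, 1%R]) (uniform_pdf 0 1 t)%:E =
    mu (`]x, +oo[ `&` `[0%R, 1%R]))%E.
  rewrite (eq_integral (fun=> 1%E)).
    by rewrite integral_cst ?mul1e//; exact: measurableI.
  move=> t; rewrite inE => -[_ /=]; rewrite in_itv/= /uniform_pdf => ->.
  by rewrite subr0 invr1.
have [x0|x0] := ltP x 0.
  rewrite min_l; last by rewrite le_max; apply/orP; right; lra.
  rewrite setIidr; first by rewrite lebesgue_measure_itv/= lte_fin ltr01 sube0.
  by move=> t /=; rewrite !in_itv/= andbT => /andP[t0 _]; exact: lt_le_trans t0.
have -> : `]x, +oo[ `&` `[0%R, 1%R] = `]x, 1%R]%classic :> set R.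
  apply/seteqP; split=> t /=; rewrite !in_itv/= ?andbT.
    by move=> [-> /andP[]].
  by move=> /andP[xt ->]; rewrite xt (le_trans x0 (ltW xt)).
rewrite lebesgue_measure_itv/= lte_fin; case: ltP => x1.
  by rewrite max_r ?min_r; [rewrite -EFinB|lra..].
by rewrite max_l ?min_r//; lra.
Qed.

(** The two probabilities agree on the open upper rays, which form an
    intersection-stable generator of the Borel sets. *)
Lemma U_uniform A : measurable A ->
  distribution P U A = uniform_prob (@ltr01 R) A.
Proof.
move=> mA.
apply: (@measure_unique _ R (measurableTypeR R) (@RGenOInfty.G R)
  (fun k => `]- k%:R, +oo[%classic)) => //.
- exact: RGenOInfty.measurableE.
- move=> _ _ [x ->] [y ->]; exists (Num.max x y).
  apply/seteqP; split=> t /=; rewrite !in_itv/= !andbT gt_max.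
    by move=> [-> ->].
  by move=> /andP[].
- by move=> k; exists (- k%:R).
- apply/seteqP; split=> // t _.
  exists (Num.bound `|t|) => //=.
  rewrite in_itv/= andbT ltrNl.
  by rewrite (le_lt_trans _ (archi_boundP (normr_ge0 t)))// -normrN ler_norm.
- move=> _ [x ->]; apply: eq_trans (esym (uniform_prob_gt x)).
  rewrite -P_U_gt.
  by congr (P _); apply/seteqP; split=> w /=; rewrite in_itv/= andbT.
- by move=> k; rewrite (le_lt_trans (probability_le1 _ _))// ltry.
Qed.

(** * The integrated quantile function *)

(** A real-valued version of the quantile function; it agrees with it off the
    endpoints of [0, 1], where the latter may be infinite. *)
Definition qreal (t : measurableTypeR R) : R :=
  if 0 < t < 1 then fine (quantile phi t) else 0.

Lemma qreal_rcdf b : 0 < b -> F b < 1 -> qreal (F b) = b.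
Proof.
move=> b0 Fb1; rewrite /qreal quantile_rcdf// Fb1 andbT.
by rewrite -[ltLHS]rcdf0 rcdf_lt// rcdf0.
Qed.

Lemma quantile_qreal t : 0 < t < 1 -> quantile phi t = (qreal t)%:E.
Proof.
move=> t01; have [b b0 Fb] := rcdf_surj_gt0 t01.
have /andP[_ t1] := t01.
by rewrite -Fb qreal_rcdf// ?quantile_rcdf ?Fb.
Qed.

Lemma qreal_ge0 t : 0 <= qreal t.
Proof.
have [t01|t01] := boolP (0 < t < 1); last by rewrite /qreal (negbTE t01).
have [b b0 Fb] := rcdf_surj_gt0 t01; have /andP[_ t1] := t01.
by rewrite -Fb qreal_rcdf// ?Fb// ltW.
Qed.

Lemma measurable_qreal : measurable_fun setT qreal.
Proof.
apply: (measurability _ (RGenOInfty.measurableE R)) => // _ [_ [x ->] <-].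
rewrite setTI; have [x0|x0] := ltP x 0.
  rewrite (_ : _ @^-1` _ = setT)//; apply/seteqP; split=> t //= _.
  by rewrite in_itv/= andbT (lt_le_trans x0)// qreal_ge0.
rewrite (_ : _ @^-1` _ = `]F x, 1[%classic)//.
apply/seteqP; split=> t /=; rewrite !in_itv/= andbT.
  move=> xt; have t01 : 0 < t < 1.
    apply: contraTT xt => /negbTE t01; rewrite /qreal t01.
    by rewrite -leNgt.
  have [b b0 Fb] := rcdf_surj_gt0 t01; have /andP[t0 t1] := t01.
  move: xt; rewrite -Fb qreal_rcdf// ?Fb// => xb.
  rewrite t1 andbT -Fb rcdf_lt//.
  by apply: le_lt_trans (rcdf_nd (ltW xb)) _; rewrite Fb.
move=> /andP[xt t1].
have t01 : 0 < t < 1 by rewrite t1 andbT (le_lt_trans (rcdf_ge0 x)).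
have [b b0 Fb] := rcdf_surj_gt0 t01.
rewrite -Fb qreal_rcdf// ?Fb// ltNge; apply/negP => /rcdf_nd.
by rewrite Fb leNgt xt.
Qed.

Lemma U_lt1 : {ae P, forall w, U w < 1}.
Proof.
have mU : measurable [set w | 1 <= U w].
  rewrite -[X in measurable X]setTI.
  by apply: measurable_fun_ler => //; exact: measurable_U.
exists [set w | 1 <= U w]; split => //; last first.
  by move=> w /= /negP; rewrite -leNgt.
apply/eqP; rewrite eq_le measure_ge0 andbT.
apply/lee_addgt0Pr => e e0; rewrite add0e.
apply: (@le_trans _ _ (P [set w | 1 - e < U w])).
  rewrite le_measure ?inE//.
    rewrite -[X in measurable X]setTI.
    by apply: measurable_fun_ltr => //; exact: measurable_U.
  by move=> w /=; apply: lt_le_trans; rewrite ltrBlDr ltrDl.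
by rewrite P_U_gt lee_fin opprB addrCA subrr addr0 ge_min (max_r (ltW e0)) lexx orbT.
Qed.

Lemma qreal_U : {ae P, forall w, qreal (U w) = phi w}.
Proof.
by apply: filterS2 phi_gt0 U_lt1 => w w0 w1; exact: qreal_rcdf.
Qed.

Lemma L1_phi : L1 phi.
Proof.
apply/integrableP; split; first exact/measurable_EFinP.
move: phi_mean; rewrite unlock => phiE.
rewrite (_ : (\int[P]_x _)%E = 1%E) ?ltry// -phiE.
apply: ae_eq_integral => //; [|exact/measurable_EFinP|].
  by apply: measurableT_comp => //; exact/measurable_EFinP.
by apply: filterS phi_gt0 => w w0 _ /=; rewrite ger0_norm// ltW.
Qed.

Lemma E_phi : E phi = 1.
Proof. by apply: EFin_inj; rewrite EFin_E ?L1_phi// -phi_mean unlock. Qed.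

Lemma measurable_U_le y : measurable [set w | U w <= y].
Proof.
rewrite -[X in measurable X]setTI.
by apply: measurable_fun_ler => //; exact: measurable_U.
Qed.

Lemma P_U_le y : 0 <= y <= 1 -> fine (P [set w | U w <= y]) = y.
Proof.
move=> /andP[y0 y1].
have -> : [set w | U w <= y] = ~` [set w | y < U w].
  by apply/seteqP; split => w /=; [rewrite leNgt => /negP|move/negP; rewrite -leNgt].
rewrite probability_setC; last first.
  rewrite -[X in measurable X]setTI.
  by apply: measurable_fun_ltr => //; exact: measurable_U.
by rewrite P_U_gt max_r ?min_r ?subr_ge0 ?gerBl//= opprB addrCA subrr addr0.
Qed.

Lemma measurable_quantile (y : R) : y <= 1 -> measurable_fun `]0, y[ (quantile phi).
Proof.
move=> y1; apply: (eq_measurable_fun (EFin \o qreal)).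
  move=> t; rewrite inE /= in_itv/= => /andP[t0 ty].
  by rewrite quantile_qreal// t0 (lt_le_trans ty).
by apply: measurable_funTS; apply/measurable_EFinP; exact: measurable_qreal.
Qed.

Lemma integral_quantile (y : R) : y <= 1 ->
  (\int[mu]_(t in `[0%R, y]) quantile phi t =
   \int[mu]_(t in `[0%R, y]) (qreal t)%:E)%E.
Proof.
move=> y1; rewrite integral_itv_bndoo; last exact: measurable_quantile.
rewrite integral_itv_bndoo; last first.
  by apply: measurable_funTS; apply/measurable_EFinP; exact: measurable_qreal.
apply: eq_integral => t; rewrite inE /= in_itv/= => /andP[t0 ty].
by rewrite quantile_qreal// t0 (lt_le_trans ty).
Qed.

(** Change of variables along the uniform rank, whose quantile is [phi]
    itself. *)
Lemma integral_qreal (y : R) : 0 <= y <= 1 ->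
  (\int[mu]_(t in `[0%R, y]) (qreal t)%:E =
   (E (fun w => phi w * \1_[set w | U w <= y] w))%:E)%E.
Proof.
move=> /andP[y0 y1].
have mf : measurable_fun setT ((EFin \o qreal) \_ `]-oo, y]).
  apply/(measurable_restrictT _ _).1 => //; apply: measurable_funTS.
  by apply/measurable_EFinP; exact: measurable_qreal.
have f0 x : (0 <= ((EFin \o qreal) \_ `]-oo, y]) x)%E.
  by rewrite patchE; case: ifP => // _; rewrite lee_fin qreal_ge0.
have mI := measurable_U_le y.
rewrite EFin_E; last first.
  apply: L1M; [exact: L1_phi|exact: measurable_indic|apply: nearW => w].
  by rewrite indicE; case: (_ \in _); rewrite ?normr1 ?normr0.
transitivity (\int[mu]_(t in `[0%R, 1%R]) ((EFin \o qreal) \_ `]-oo, y]) t)%E.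
  rewrite -integral_mkcondr; congr (integral _ _ _).
  apply/seteqP; split=> t /=; rewrite !in_itv/=.
    by move=> /andP[-> ty]; rewrite ty (le_trans ty).
  by move=> [/andP[-> _] ->].
have := integral_uniform (@ltr01 R) mf f0.
rewrite subr0 invr1 mul1e => <-.
rewrite -(@eq_measure_integral _ _ _ _ _ (distribution P U)); last first.
  by move=> A mA _; exact: U_uniform.
rewrite ge0_integral_distribution//.
apply: ae_eq_integral => //.
- by apply: measurableT_comp => //; exact: measurable_U.
- by apply/measurable_EFinP/measurable_funM => //; exact: measurable_indic.
apply: filterS qreal_U => w qw _ /=.
rewrite patchE indicE /= qw.
have [Uy|/negP Uy] := boolP (U w <= y).
  by rewrite !mem_set//= ?in_itv//= mulr1.
by rewrite !memNset//= ?in_itv//= mulr0.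
Qed.

Lemma Phi_E y : 0 <= y <= 1 ->
  Phi phi y = E (fun w => phi w * \1_[set w | U w <= y] w).
Proof.
move=> y01; have /andP[_ y1] := y01.
rewrite -[RHS]/(fine (_)%:E) -integral_qreal// -integral_quantile//.
Qed.

Lemma Phi_continuous : {within `[0, 1], continuous (Phi phi)}.
Proof.
apply: (@subspace_eq_continuous _ _ _ (fun x => parameterized_integral mu 0 x qreal)).
  move=> y; rewrite inE/= in_itv/= => y01; have /andP[_ y1] := y01.
  by rewrite /parameterized_integral /Rintegral -integral_quantile.
apply: parameterized_integral_continuous => //.
apply/integrableP; split.
  by apply: measurable_funTS; apply/measurable_EFinP; exact: measurable_qreal.
rewrite (eq_integral (EFin \o qreal)) ?integral_qreal ?ler01 ?lexx ?ltry//.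
by move=> t _ /=; rewrite ger0_norm// qreal_ge0.
Qed.

Lemma L1_phi_indic A : measurable A -> L1 (fun w => phi w * \1_A w).
Proof.
move=> mA; apply: L1M; [exact: L1_phi|exact: measurable_indic|apply: nearW => w].
by rewrite indicE; case: (_ \in _); rewrite ?normr1 ?normr0.
Qed.

Lemma Phi_level_set y : 0 <= y <= 1 ->
  exists A, [/\ measurable A, E (\1_A : T -> R) = y
              & Phi phi y = E (fun w => phi w * \1_A w)].
Proof.
move=> y01; exists [set w | U w <= y]; have mU := measurable_U_le y.
by split=> //; [rewrite E_indic// P_U_le|exact: Phi_E].
Qed.

Lemma Phi_ge0 y : 0 <= y <= 1 -> 0 <= Phi phi y.
Proof.
move=> /Phi_level_set[A [mA _ ->]]; apply: E_ge0.
  exact: L1_measurable (L1_phi_indic mA).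
by apply: filterS phi_gt0 => w w0; rewrite mulr_ge0 ?(ltW w0).
Qed.

Lemma Phi0 : Phi phi 0 = 0.
Proof.
have [|A [mA PA ->]] := @Phi_level_set 0; first by rewrite lexx ler01.
have A0 : {ae P, forall w, \1_A w = 0 :> R}.
  apply: E_eq0; [exact: L1_indic|exact: nearW|by rewrite PA].
rewrite -[RHS](E_cst P); apply: E_ae => //.
  exact: L1_measurable (L1_phi_indic mA).
by apply: filterS A0 => w ->; rewrite mulr0.
Qed.

Lemma Phi1 : Phi phi 1 = 1.
Proof.
have [|A [mA PA ->]] := @Phi_level_set 1; first by rewrite lexx ler01.
have A1 : {ae P, forall w, 1 - \1_A w = 0 :> R}.
  apply: E_eq0.
  - by apply: L1B; [exact: L1_cst|exact: L1_indic].
  - by apply: nearW => w; rewrite subr_ge0 indicE lern1 leq_b1.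
  - by rewrite EB; [rewrite E_cst PA subrr|exact: L1_cst|exact: L1_indic].
rewrite -[RHS]E_phi; apply: E_ae => //.
  exact: L1_measurable (L1_phi_indic mA).
by apply: filterS A1 => w /eqP; rewrite subr_eq0 => /eqP <-; rewrite mulr1.
Qed.

Let B b := [set w | phi w <= b].

Lemma E_phi_le b : E (\1_(B b) : T -> R) = F b.
Proof. by rewrite E_indic ?rcdfE//; exact: measurable_phi_le. Qed.

Lemma indicB b w : \1_(B b) w = (if phi w <= b then 1 else 0) :> R.
Proof.
rewrite indicE; case: ifPn => wb; first by rewrite mem_set.
by rewrite memNset//; exact/negP.
Qed.

(** [phi <= b] is the set where [phi - b] is nonpositive, hence it minimizes
    [E[phi - b; A]]; as [phi] does not take the value [b], the minimizer is
    unique up to null events. *)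
Lemma phi_lower_set_min A b : measurable A ->
  let D := E (fun w => phi w * \1_A w) - E (fun w => phi w * \1_(B b) w)
           - b * (E (\1_A : T -> R) - F b) in
  0 <= D /\ (D <= 0 -> E (\1_A : T -> R) = F b).
Proof.
move=> mA D; have mB := measurable_phi_le b.
have LA := L1_indic P mA; have LB := L1_indic P mB.
have LfA := L1_phi_indic mA; have LfB := L1_phi_indic mB.
pose s w := (phi w * \1_A w - phi w * \1_(B b) w) - b * (\1_A w - \1_(B b) w).
have LAB := L1B LA LB.
have Ls : L1 s by apply: L1B; [exact: L1B|exact: L1Z].
have Es : E s = D.
  rewrite EB; [|exact: L1B|exact: L1Z].
  by rewrite EB// EZ// EB// E_phi_le.
have sE w : s w = (phi w - b) * (\1_A w - \1_(B b) w) by rewrite /s; ring.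
have s0 : {ae P, forall w, 0 <= s w}.
  apply: nearW => w; rewrite sE indicB indicE.
  by have [h|h] := leP (phi w) b; case: (_ \in _) => /=; nra.
split; first by rewrite -Es; exact: E_ge0 (L1_measurable Ls) s0.
rewrite -Es => Es0; rewrite -E_phi_le.
apply: E_ae; [exact: L1_measurable LA|exact: L1_measurable LB|].
apply: filterS2 (phi_neq b) (E_eq0 Ls s0 Es0) => w wb /eqP.
by rewrite sE mulf_eq0 !subr_eq0 (negbTE wb) => /eqP.
Qed.

Lemma Phi_rcdf b : 0 < b -> Phi phi (F b) = E (fun w => phi w * \1_(B b) w).
Proof.
move=> b0; have F01 : 0 <= F b <= 1 by rewrite rcdf_ge0 rcdf_le1.
rewrite Phi_E//; have mB := measurable_phi_le b; have mU := measurable_U_le (F b).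
have LB := L1_indic P mB; have LU := L1_indic P mU.
have BU : {ae P, forall w, \1_[set w | U w <= F b] w - \1_(B b) w = 0 :> R}.
  apply: E_eq0; first exact: L1B.
    apply: nearW => w; rewrite indicB; case: ifPn => wb.
      by rewrite indicE mem_set ?subrr//=; exact: rcdf_nd.
    by rewrite subr0.
  by rewrite EB// E_phi_le E_indic// P_U_le// subrr.
apply: E_ae.
- exact: L1_measurable (L1_phi_indic mU).
- exact: L1_measurable (L1_phi_indic mB).
by apply: filterS BU => w /eqP; rewrite subr_eq0 => /eqP ->.
Qed.

(** Strict convexity of [Phi], with supporting slope [b] at [F b]. *)
Lemma Phi_tangent b y : 0 < b -> 0 <= y <= 1 -> y != F b ->
  Phi phi (F b) + b * (y - F b) < Phi phi y.
Proof.
move=> b0 y01 yF; have [A [mA PA ->]] := Phi_level_set y01.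
have [D0 D1] := phi_lower_set_min b mA.
rewrite Phi_rcdf// -PA ltNge; apply/negP => h; move: yF.
by rewrite -PA D1 ?eqxx//; lra.
Qed.

Lemma Phi_lt x y : 0 <= x -> x < y -> y <= 1 -> Phi phi x < Phi phi y.
Proof.
have pos z t : 0 < z -> z < t -> t <= 1 -> Phi phi z < Phi phi t.
  move=> z0 zt t1; have [|b b0 Fb] := @rcdf_surj_gt0 z.
    by rewrite z0 (lt_le_trans zt).
  have H := @Phi_tangent b t b0; rewrite Fb in H; apply: lt_trans (H _ _).
  - by rewrite ltrDl mulr_gt0// subr_gt0.
  - by rewrite t1 andbT ltW// (lt_trans z0).
  - by rewrite gt_eqF.
rewrite le_eqVlt => /orP[/eqP <-|]; last exact: pos.
move=> y0 y1; rewrite Phi0; apply: (@le_lt_trans _ _ (Phi phi (y / 2))).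
  by apply: Phi_ge0; lra.
by apply: pos; lra.
Qed.

Lemma Phi_le_inv x y : 0 <= x -> y <= 1 -> Phi phi y <= Phi phi x -> y <= x.
Proof.
move=> x0 y1 Pyx; rewrite leNgt; apply/negP => xy.
by move: Pyx; rewrite leNgt Phi_lt.
Qed.

End price_quantile.

(** * The maximizer of the ratio *)

Section optimal_levels.
Context (d : measure_display) (T : measurableType d) (R : realType).
Context (P : probability T R) (phi : {RV P >-> R}).

Notation L1 f := (P.-integrable setT (EFin \o f%R)).
Notation E f := (\int[P]_x f x)%R.

Hypothesis phi_gt0 : {ae P, forall w, 0 < phi w}.
Hypothesis phi_mean : ('E_P[phi] = 1)%E.
Hypothesis cdf_cont : continuous (cdf phi).
Hypothesis cdf_incr : forall x y : R, 0 < x -> x < y -> (cdf phi y < 1)%E ->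
  (cdf phi x < cdf phi y)%E.

Notation F := (rcdf phi).
Let Phi0 := Phi0 phi_gt0 phi_mean cdf_cont cdf_incr.
Let Phi1 := Phi1 phi_gt0 phi_mean cdf_cont cdf_incr.
Let Phi_lt := Phi_lt phi_gt0 phi_mean cdf_cont cdf_incr.
Let Phi_tangent := Phi_tangent phi_gt0 phi_mean cdf_cont cdf_incr.
Let Phi_continuous := Phi_continuous phi_gt0 phi_mean cdf_cont cdf_incr.

Let Phi_gt0 y : 0 < y <= 1 -> 0 < Phi phi y.
Proof. by move=> /andP[y0 y1]; rewrite -Phi0 Phi_lt. Qed.

Variables (lam v : R).
Hypotheses (lam_gt0 : 0 < lam) (lam_le1 : lam <= 1).
Hypotheses (v_ge0 : 0 <= v) (v_le1 : v <= 1).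

Lemma z_ofP : 0 <= z_of phi v <= 1 /\ Phi phi (z_of phi v) = 1 - v.
Proof.
have [|c c01 Pc] := @IVT R (Phi phi) 0 1 (1 - v) ler01 Phi_continuous.
  by rewrite Phi0 Phi1 min_l ?ler01// max_r ?ler01// subr_ge0 v_le1 gerBl v_ge0.
have := @xgetPex _ 0 [set z | z \in `[0, 1] /\ Phi phi z = 1 - v]
  (ex_intro _ c (conj c01 Pc)).
by rewrite -/(z_of phi v) /= in_itv.
Qed.

Notation f y := ((y + lam - 1) / Phi phi y).

(** Where [y + lam - 1] touches [C Phi y] from below, the tangent to [Phi] has
    slope [1 / C]; at any other point the strict tangent inequality would
    violate the bound. *)
Lemma maximizer_rcdf C y : 0 < C -> 0 <= y <= 1 ->
  (forall y', 0 <= y' <= 1 -> y' + lam - 1 <= C * Phi phi y') ->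
  y + lam - 1 = C * Phi phi y -> y = F C^-1.
Proof.
move=> C0 y01 fC fy; apply/eqP/contraT => yF.
have := Phi_tangent _ y01 yF; rewrite invr_gt0 => /(_ C0).
rewrite -(ltr_pM2l C0) mulrDr mulrA divff ?gt_eqF// mul1r -fy.
have := fC (F C^-1); rewrite rcdf_ge0 rcdf_le1 => /(_ isT).
by lra.
Qed.

Let is_max y := y \in `]1 - lam, 1] /\
    forall y', y' \in `]0, 1] -> y' != y -> f y' < f y.

Lemma is_max_spec y : is_max y ->
  [/\ 1 - lam < y <= 1, 0 < f y, y = F (f y)^-1,
     y + lam - 1 = f y * Phi phi y &
     forall y', 0 <= y' <= 1 -> y' + lam - 1 <= f y * Phi phi y'].
Proof.
move: lam_gt0 lam_le1 => l0 l1 [y1 fy]; move: (y1); rewrite in_itv/= => /andP[ly yl].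
have y0 : 0 < y by lra.
have Py : 0 < Phi phi y by rewrite Phi_gt0// y0.
have f0 : 0 < f y by rewrite divr_gt0//; lra.
have fmax y' : 0 <= y' <= 1 -> y' + lam - 1 <= f y * Phi phi y'.
  move=> /andP[]; rewrite le_eqVlt => /orP[/eqP <- _|y'0 y'1].
    by rewrite Phi0 mulr0; lra.
  rewrite -ler_pdivrMr ?Phi_gt0 ?y'0//.
  have [->//|yy] := eqVneq y' y.
  by apply: ltW; apply: fy => //; rewrite in_itv/= y'0.
have fyE : y + lam - 1 = f y * Phi phi y by rewrite divfK// gt_eqF.
split=> //.
by apply: maximizer_rcdf => //; rewrite (ltW y0).
Qed.

(** The extreme value theorem applies on [1 - lam, 1], where [Phi] is bounded
    away from 0; to the left of that interval the ratio is nonpositive.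
    Uniqueness holds as all maximizers equal [F (1 / C)]. *)
Lemma is_max_ex : lam < 1 -> exists y, is_max y.
Proof.
move: lam_gt0 => l0 lam1; have l01 : 0 <= 1 - lam <= 1 by apply/andP; split; lra.
pose m := Phi phi (1 - lam).
have m0 : 0 < m by apply: Phi_gt0; apply/andP; split; lra.
have mP t : 1 - lam <= t <= 1 -> m <= Phi phi t.
  move=> /andP[]; rewrite le_eqVlt => /orP[/eqP <-//|lt t1].
  by apply: ltW; apply: Phi_lt => //; lra.
have fc : {within `[1 - lam, 1], continuous (fun y => f y)}.
  have Pc : {within `[1 - lam, 1], continuous (Phi phi)}.
    apply: continuous_subspaceW Phi_continuous => t /=.
    rewrite !in_itv/= => /andP[lt ->].
    by rewrite andbT; lra.
  move=> t; have [lt|lt] := pselect (`[1 - lam, 1]%classic t); last first.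
    move=> C /nbhs_singleton Cft.
    (* points outside a subspace are isolated in its topology *)
    change (nbhs_subspace t ((fun y => f y) @^-1` C)).
    by rewrite -nbhs_subspace_out// => _ ->.
  apply: cvgM.
    have : {within `[1 - lam, 1], continuous (fun y => y + lam - 1)}.
      apply: continuous_subspaceT => x; apply: cvgB; last exact: cvg_cst.
      by apply: cvgD; [exact: cvg_id|exact: cvg_cst].
    exact.
  apply: cvgV; last exact: Pc.
  move: lt; rewrite /= in_itv/= => /mP mt.
  by rewrite gt_eqF// (lt_le_trans m0 mt).
have [|y] := @EVT_max R (fun y => f y) (1 - lam) 1 _ fc; first lra.
rewrite in_itv/= => /andP[ly yl] ymax.
pose C := f y.
have C0 : 0 < C.
  apply: (@lt_le_trans _ _ (f 1)); first by rewrite Phi1; lra.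
  by apply: ymax; rewrite in_itv/=; lra.
have Cmax y' : 0 <= y' <= 1 -> y' + lam - 1 <= C * Phi phi y'.
  move=> /andP[y'0 y'1]; have [ly'|ly'] := leP (1 - lam) y'.
    have Py' : 0 < Phi phi y' by apply: lt_le_trans (mP _ _); rewrite ?ly'.
    by rewrite -ler_pdivrMr//; apply: ymax; rewrite in_itv/= ly'.
  apply: (@le_trans _ _ 0); first lra.
  by rewrite mulr_ge0 ?(ltW C0)// (Phi_ge0 phi_gt0 phi_mean cdf_cont cdf_incr)// y'0.
have Py : 0 < Phi phi y by apply: lt_le_trans (mP _ _); rewrite ?ly.
have yC : y + lam - 1 = C * Phi phi y by rewrite divfK// gt_eqF.
have y0 : 1 - lam < y.
  by have := mulr_gt0 C0 Py; rewrite -yC; lra.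
exists y; split; first by rewrite in_itv/= y0.
move=> y'; rewrite in_itv/= => /andP[y'0 y'1] y'y.
have y'01 : 0 <= y' <= 1 by rewrite (ltW y'0).
rewrite ltr_pdivrMr ?Phi_gt0 ?y'0// lt_neqAle Cmax// andbT.
apply: contraNneq y'y => Cy'.
have yF : y = F C^-1 by apply: maximizer_rcdf => //; apply/andP; split; lra.
by rewrite yF (maximizer_rcdf C0 y'01 Cmax Cy').
Qed.

Lemma y_lambdaP : lam < 1 -> is_max (y_lambda phi lam).
Proof. by move=> /is_max_ex[y ymax]; apply: xgetPex; exists y. Qed.

(** A maximizer with maximum [C] would bound [Phi y / y] below by [1 / C], but
    [Phi (F b) <= b F b] with [b] arbitrarily small. *)
Lemma y_lambda1 : lam = 1 -> y_lambda phi lam = 0.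
Proof.
move=> l1; apply: xgetPN => y ymax.
have [y1 C0 yF yC Cmax] := is_max_spec ymax.
set C := f y in C0 yF yC Cmax.
pose b := C^-1 / 2.
have b0 : 0 < b by rewrite divr_gt0// invr_gt0.
have Fb0 : 0 < F b.
  have := rcdf_lt phi_gt0 cdf_incr (lexx 0) b0.
  by rewrite (rcdf0 phi_gt0); apply.
have F01 : 0 <= F b <= 1 by rewrite (ltW Fb0) rcdf_le1.
have := Phi_tangent b0 (y := 0); rewrite lexx ler01 lt_eqF// Phi0 => /(_ isT isT).
have := Cmax _ F01; rewrite l1 addrK => FC; rewrite sub0r mulrN subr_lt0 => Pb.
have : C * Phi phi (F b) < C * (b * F b) by rewrite ltr_pM2l.
rewrite /b mulrA mulrA divff ?gt_eqF//; lra.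
Qed.

End optimal_levels.

(** * Optimal positions *)

Section solution.
Context (d : measure_display) (T : measurableType d) (R : realType).
Context (P : probability T R) (phi : {RV P >-> R}).

Notation L1 f := (P.-integrable setT (EFin \o f%R)).
Notation E f := (\int[P]_x f x)%R.

Hypothesis phi_gt0 : {ae P, forall w, 0 < phi w}.
Hypothesis phi_mean : ('E_P[phi] = 1)%E.
Hypothesis cdf_cont : continuous (cdf phi).
Hypothesis cdf_incr : forall x y : R, 0 < x -> x < y -> (cdf phi y < 1)%E ->
  (cdf phi x < cdf phi y)%E.

Notation F := (rcdf phi).
Notation U := (U phi).
Let Lphi := L1_phi phi_gt0 phi_mean.

Lemma phi_lt_esssup : {ae P, forall w, ((phi w)%:E < 'N[P]_+oo[EFin \o phi])%E}.
Proof.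
have NE : ('N[P]_+oo[EFin \o phi] = ess_sup P (abse \o (EFin \o phi)))%E.
  rewrite unlock ifT//; apply: (lt_le_trans lte01).
  by have := lexx (P setT); rewrite {1}probability_setT.
rewrite NE; set s := ess_sup _ _.
have phis := ess_sup_ge P (abse \o (EFin \o phi)).
rewrite -/s in phis; case: s phis => [r| |] phis.
- apply: filterS3 phi_gt0 (phi_neq cdf_cont r) phis => w w0 wr.
  by rewrite /= lee_fin lte_fin ger0_norm ?(ltW w0)// lt_neqAle wr.
- by apply: nearW => w; rewrite ltry.
- by apply: filterS phis => w; rewrite leeNy_eq.
Qed.

(** Passing to the rank treats all levels alike, including [y = 1], where the
    quantile is the possibly infinite essential supremum. *)
Lemma quantile_le_phi y : 0 <= y <= 1 ->
  {ae P, forall w, (quantile phi y <= (phi w)%:E)%E = (y < U w)}.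
Proof.
move=> /andP[]; rewrite le_eqVlt => /orP[/eqP <- _|y0].
  apply: filterS phi_gt0 => w w0; rewrite /quantile eqxx lee_fin (ltW w0).
  by rewrite -(rcdf0 phi_gt0) (rcdf_lt phi_gt0 cdf_incr (lexx 0) w0)// rcdf0.
rewrite le_eqVlt => /orP[/eqP ->|y1].
  apply: filterS phi_lt_esssup => w w1.
  by rewrite /quantile eqxx oner_eq0 leNgt w1 ltNge rcdf_le1.
have [|b b0 Fb] := rcdf_surj_gt0 phi_gt0 cdf_cont (t := y); first by rewrite y0.
apply: filterS (phi_neq cdf_cont b) => w wb.
rewrite -Fb (quantile_rcdf phi_gt0 cdf_incr b0) ?Fb// lee_fin -Fb.
rewrite (rcdf_gtE phi_gt0 cdf_incr _ (ltW b0)) ?Fb//.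
by rewrite lt_neqAle eq_sym wb.
Qed.

Lemma measurable_level b : measurable [set w | (b <= (phi w)%:E)%E].
Proof.
rewrite -[X in measurable X]setTI; apply: emeasurable_fun_c_infty => //.
exact/measurable_EFinP.
Qed.

Lemma level_ae y : 0 <= y <= 1 ->
  {ae P, forall w, indic_ge phi (quantile phi y) w = 1 - \1_[set w | U w <= y] w}.
Proof.
move=> y01; apply: filterS (quantile_le_phi y01) => w qw.
rewrite /indic_ge !indicE; have [h|h] := leP (U w) y.
  by rewrite memNset ?mem_set ?subrr//= qw ltNge h.
by rewrite mem_set ?memNset ?subr0//= ?qw// leNgt h.
Qed.

Lemma measurable_indic_ge b : measurable_fun setT (indic_ge phi b).
Proof. by apply: measurable_indic; exact: measurable_level. Qed.

Lemma indic_ge01 b w : 0 <= indic_ge phi b w <= 1.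
Proof. by rewrite /indic_ge indicE ler0n lern1 leq_b1. Qed.

Lemma L1_phi_indic_ge b : L1 (fun w => phi w * indic_ge phi b w).
Proof. by apply: L1_phi_indic => //; exact: measurable_level. Qed.

Lemma E_indic_ge y : 0 <= y <= 1 -> E (indic_ge phi (quantile phi y)) = 1 - y.
Proof.
move=> y01; have mU := measurable_U_le phi y; have LU := L1_indic P mU.
have L1U := L1B (L1_cst P 1) LU.
rewrite (E_ae (measurable_indic_ge _) (L1_measurable L1U) (level_ae y01)).
by rewrite EB// ?E_cst ?E_indic// ?P_U_le//; exact: L1_cst.
Qed.

Lemma E_phi_indic_ge y : 0 <= y <= 1 ->
  E (fun w => phi w * indic_ge phi (quantile phi y) w) = 1 - Phi phi y.
Proof.
move=> y01; have mU := measurable_U_le phi y.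
have LU := L1_phi_indic phi_gt0 phi_mean mU.
rewrite (Phi_E phi_gt0 phi_mean cdf_cont cdf_incr)//.
rewrite -(E_phi phi_gt0 phi_mean) -EB//; apply: E_ae.
- exact: L1_measurable (L1_phi_indic_ge _).
- exact: L1_measurable (L1B Lphi LU).
by apply: filterS (level_ae y01) => w ->; ring.
Qed.

Lemma E_put kap : 0 < kap ->
  E (fun w => Num.max 0 (1 - kap * phi w)) = F kap^-1 - kap * Phi phi (F kap^-1).
Proof.
move=> k0; have b0 : 0 < kap^-1 by rewrite invr_gt0.
rewrite (Phi_rcdf phi_gt0 phi_mean cdf_cont cdf_incr b0).
have mB := measurable_phi_le phi kap^-1.
have LB := L1_phi_indic phi_gt0 phi_mean mB.
rewrite -[X in X - _]E_phi_le -EZ// -EB; [|exact: L1_indic|exact: L1Z].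
apply: eq_Rintegral => w _; rewrite indicB.
have -> : (phi w <= kap^-1) = (kap * phi w <= 1).
  by rewrite -ler_pdivlMl// mulr1.
case: leP => h; [rewrite max_r; lra|rewrite max_l; lra].
Qed.

Lemma E_call kap : 0 < kap ->
  E (fun w => Num.max 0 (kap * phi w - 1)) =
  kap - 1 + F kap^-1 - kap * Phi phi (F kap^-1).
Proof.
move=> k0; rewrite -addrA -E_put//.
have mkphi : measurable_fun setT (fun w => kap * phi w).
  exact: L1_measurable (L1Z kap Lphi).
have Lp : L1 (fun w => Num.max 0 (1 - kap * phi w)).
  apply: L1_unit; first by apply: measurable_maxr => //; exact: measurable_funB.
  apply: filterS phi_gt0 => w w0; rewrite le_max lexx/= ge_max ler01/=.
  by rewrite gerBl mulr_ge0// ltW.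
have L := L1B (L1Z kap Lphi) (L1_cst P 1).
transitivity (E (fun w => (kap * phi w - 1) + Num.max 0 (1 - kap * phi w))).
  apply: eq_Rintegral => w _; have [h|h] := leP (kap * phi w) 1.
    by rewrite max_l ?max_r; lra.
  by rewrite max_r ?max_l; lra.
rewrite ED// EB//; [|exact: L1Z|exact: L1_cst].
by rewrite EZ// E_phi// mulr1 E_cst.
Qed.

Variables (lam v : R).
Hypotheses (lam_gt0 : 0 < lam) (lam_le1 : lam <= 1).
Hypotheses (v_ge0 : 0 <= v) (v_le1 : v <= 1).

Definition two_level (b y : R) : T -> R :=
  fun w => b + (1 - b) * indic_ge phi (quantile phi y) w.

Lemma two_level0 y : two_level 0 y = indic_ge phi (quantile phi y).
Proof. by apply/funext => w; rewrite /two_level add0r subr0 mul1r. Qed.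

Lemma admissible_two_level b y : 0 <= b <= 1 -> 0 <= y <= 1 ->
  (1 - b) * Phi phi y = 1 - v -> admissible phi v (two_level b y).
Proof.
move=> /andP[b0 b1] y01 bv; apply/admissibleP => //; split.
- apply: measurable_funD => //; apply: measurable_funM => //.
  exact: measurable_indic_ge.
- apply: nearW => w; have /andP[i0 i1] := indic_ge01 (quantile phi y) w.
  by rewrite /two_level; apply/andP; split; nra.
have Li := L1_phi_indic_ge (quantile phi y).
have -> : E (fun w => phi w * two_level b y w) = E (fun w => b * phi w +
    (1 - b) * (phi w * indic_ge phi (quantile phi y) w)).
  by apply: eq_Rintegral => w _; rewrite /two_level; ring.
rewrite ED; [|exact: L1Z|exact: L1Z].
rewrite EZ// (EZ _ Li) E_phi// E_phi_indic_ge//; lra.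
Qed.

Lemma AVaR_two_level_le b y : 0 <= b <= 1 -> 0 <= y <= 1 ->
  (AVaR P lam (\- two_level b y)%R <= (b + (1 - b) * ((1 - y) / lam))%:E)%E.
Proof.
move=> b01 y01; have mL := measurable_level (quantile phi y).
have := AVaR_two_level P lam_gt0 mL b01.
by rewrite -(E_indic P mL) -/(indic_ge phi (quantile phi y)) E_indic_ge.
Qed.

Lemma two_level_optimal kap th b y : 0 < kap -> 0 <= th <= 1 ->
  th * E (fun w => Num.max 0 (1 - kap * phi w)) = 1 - lam ->
  0 <= b <= 1 -> 0 <= y <= 1 -> (1 - b) * Phi phi y = 1 - v ->
  b + (1 - b) * ((1 - y) / lam) = dual_value phi lam v kap ->
  NP_unique_solution phi lam v (two_level b y) /\
  min_risk phi lam v = (b + (1 - b) * ((1 - y) / lam))%:E.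
Proof.
move=> k0 th01 thE b01 y01 bv bE; rewrite bE.
apply: (dual_certificate lam_gt0 Lphi phi_gt0 k0 th01 thE).
- apply: filterS (phi_neq cdf_cont kap^-1) => w; apply: contra => /eqP kw.
  by rewrite -[kap^-1]mulr1 -kw mulKf// gt_eqF.
- exact: admissible_two_level.
- by rewrite -bE; exact: AVaR_two_level_le.
Qed.

Lemma mean_le_AVaR Y : admissible phi v Y -> ((E Y)%:E <= AVaR P lam (\- Y)%R)%E.
Proof.
move=> /(admissibleP _ Lphi)[mY Y01 _].
have g01 : {ae P, forall w : T, 0 <= lam <= 1}.
  by apply: nearW => w; rewrite (ltW lam_gt0).
have := AVaR_ge lam_gt0 (measurable_cst lam) mY g01 Y01 (E_cst P lam).
by rewrite EZ; [rewrite mulrC mulKf// gt_eqF|exact: L1_unit].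
Qed.

(** By [mean_le_AVaR] a position of risk 0 has mean 0, so it vanishes. *)
Lemma optimal_v0 : v = 0 ->
  NP_unique_solution phi lam v (indic_ge phi (quantile phi 1)) /\
  min_risk phi lam v = 0%:E.
Proof.
move=> v0; have i01 : 0 <= (1 : R) <= 1 by rewrite ler01 lexx.
have z01 : 0 <= (0 : R) <= 1 by rewrite lexx ler01.
have mean0 Y : admissible phi v Y -> 0 <= E Y.
  move=> /(admissibleP _ Lphi)[mY Y01 _]; apply: E_ge0 => //.
  by apply: filterS Y01 => w /andP[].
apply: (lower_bound_certificate (B := 0%:E)).
- rewrite -two_level0; apply: admissible_two_level => //.
  by rewrite (Phi1 phi_gt0 phi_mean cdf_cont cdf_incr) v0; ring.
- rewrite -two_level0; apply: le_trans (AVaR_two_level_le z01 i01) _.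
  by rewrite lee_fin subrr mul0r mulr0 addr0.
- by move=> Y aY; apply: le_trans (mean_le_AVaR aY); rewrite lee_fin mean0.
- move=> Y aY AY; have := le_trans (mean_le_AVaR aY) AY; rewrite lee_fin => EY.
  have [mY Y01 _] := (admissibleP v Lphi Y).1 aY.
  have Y0 : {ae P, forall w, Y w = 0}.
    apply: E_eq0 EY; first exact: L1_unit.
    by apply: filterS Y01 => w /andP[].
  apply: filterS2 Y0 (level_ae i01) => w -> ->.
  by rewrite indicE mem_set ?subrr//= rcdf_le1.
Qed.

(** The constraint [E[phi X] >= 1 = E[phi]] leaves only [X = 1]. *)
Lemma optimal_v1 : lam = 1 -> v = 1 ->
  NP_unique_solution phi lam v (indic_ge phi (quantile phi 0)) /\
  min_risk phi lam v = 1%:E.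
Proof.
move=> l1 v1; have z01 : 0 <= (0 : R) <= 1 by rewrite lexx ler01.
have aY1 Y : admissible phi v Y -> {ae P, forall w, Y w = 1}.
  move=> /(admissibleP _ Lphi)[mY Y01 vY].
  have LfY := L1_phiM Lphi mY Y01.
  have r0 : {ae P, forall w, phi w - phi w * Y w = 0}.
    apply: E_eq0; first exact: L1B.
      apply: filterS2 phi_gt0 Y01 => w w0 /andP[_ Y1].
      by rewrite subr_ge0 ler_piMr// ltW.
    by rewrite EB// E_phi// subr_le0 -v1.
  apply: filterS2 phi_gt0 r0 => w w0 /eqP.
  by rewrite -[X in X - _]mulr1 -mulrBr mulf_eq0 gt_eqF//= subr_eq0 => /eqP.
have aX : admissible phi v (indic_ge phi (quantile phi 0)).
  rewrite -two_level0; apply: admissible_two_level => //.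
  by rewrite (Phi0 phi_gt0 phi_mean cdf_cont cdf_incr) v1; ring.
apply: (lower_bound_certificate (B := 1%:E)) => //.
- rewrite -two_level0; apply: le_trans (AVaR_two_level_le z01 z01) _.
  by rewrite lee_fin l1 !subr0 divr1 mulr1 add0r.
- move=> Y aY; apply: le_trans (mean_le_AVaR aY); rewrite lee_fin.
  have [mY Y01 _] := (admissibleP v Lphi Y).1 aY.
  by rewrite (E_ae mY _ (aY1 Y aY)) ?E_cst.
- by move=> Y aY _; apply: filterS2 (aY1 Y aY) (aY1 _ aX) => w -> ->.
Qed.

Let Phi0 := Phi0 phi_gt0 phi_mean cdf_cont cdf_incr.
Let Phi1 := Phi1 phi_gt0 phi_mean cdf_cont cdf_incr.
Let Phi_lt := Phi_lt phi_gt0 phi_mean cdf_cont cdf_incr.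
Let Phi_tangent := Phi_tangent phi_gt0 phi_mean cdf_cont cdf_incr.

Let z := z_of phi v.
Let y := y_lambda phi lam.

Lemma lam_cases : lam = 1 \/ lam < 1.
Proof. by move: lam_le1; rewrite le_eqVlt => /orP[/eqP|]; [left|right]. Qed.

(** For [z] inside the unit interval, the multiplier is [1 / b] with [b] the
    quantile at [z].  The normalization requires
    [1 - lam <= z - Phi z / b], i.e. [Phi z <= b (z + lam - 1)].  For [lam = 1]
    this is the tangent inequality at 0; otherwise it holds at [y_lambda],
    as [1 / C_lambda <= b], and the tangent of slope [b] at [z] propagates it
    to [z]. *)
Lemma optimal_low : v <= v_lambda phi lam ->
  NP_unique_solution phi lam v (indic_ge phi (quantile phi z)) /\
  min_risk phi lam v = ((1 - z) / lam)%:E.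
Proof.
move: lam_gt0 lam_le1 v_ge0 v_le1 => l0 l1 v0 v1 vl.
have [z01 Pz] := z_ofP phi_gt0 phi_mean cdf_cont cdf_incr v0 v1.
rewrite -/z in z01 Pz.
have y01 : 0 <= y <= 1.
  case: lam_cases => [le1|lt1].
    by rewrite /y (y_lambda1 phi_gt0 phi_mean cdf_cont cdf_incr l0 l1 le1) lexx ler01.
  have [+ _] := y_lambdaP phi_gt0 phi_mean cdf_cont cdf_incr l0 lt1.
  by rewrite in_itv/= -/y => /andP[ly ->]; rewrite andbT; lra.
have yz : y <= z.
  have /andP[z0 _] := z01; have /andP[_ y1] := y01.
  apply: (Phi_le_inv phi_gt0 phi_mean cdf_cont cdf_incr z0 y1).
  by rewrite Pz; move: vl; rewrite /v_lambda -/y; lra.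
have /andP[] := z01; rewrite le_eqVlt => /orP[/eqP z0 _|z0].
  have le1 : lam = 1.
    case: lam_cases => // lt1.
    have [+ _] := y_lambdaP phi_gt0 phi_mean cdf_cont cdf_incr l0 lt1.
    by rewrite in_itv/= -/y => /andP[ly _]; lra.
  rewrite -z0 subr0 le1 divr1 -[in NP_unique_solution _ _]le1 -[in min_risk _ _]le1.
  by apply: optimal_v1 => //; move: Pz; rewrite -z0 Phi0; lra.
rewrite le_eqVlt => /orP[/eqP z1|z1].
  rewrite z1 subrr mul0r; apply: optimal_v0.
  by move: Pz; rewrite z1 Phi1; lra.
have [|b b0 Fb] := rcdf_surj_gt0 phi_gt0 cdf_cont (t := z); first by rewrite z0.
have k0 : 0 < b^-1 by rewrite invr_gt0.
have Fk : F (b^-1)^-1 = z by rewrite invrK.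
have tan0 : Phi phi z < b * z.
  have := @Phi_tangent b 0 b0; rewrite lexx ler01 Fb lt_eqF// Phi0 => /(_ isT isT).
  lra.
have tanl : Phi phi z <= b * (z + lam - 1).
  case: lam_cases => [->|lt1]; first by rewrite addrK ltW.
  have [_ C0 yF yC _] := is_max_spec phi_gt0 phi_mean cdf_cont cdf_incr l0 l1
    (y_lambdaP phi_gt0 phi_mean cdf_cont cdf_incr l0 lt1).
  rewrite -/y in C0 yF yC; set C := _ / _ in C0 yF yC.
  have bC : C^-1 <= b.
    rewrite leNgt; apply/negP => bC.
    have := rcdf_lt phi_gt0 cdf_incr (ltW b0) bC.
    by rewrite Fb -yF => /(_ z1); lra.
  have Py : Phi phi y = C^-1 * (y + lam - 1) by rewrite yC mulKf// gt_eqF.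
  have CPy : 0 <= y + lam - 1.
    by rewrite yC mulr_ge0 ?(ltW C0)//; apply: Phi_ge0.
  have Pyb : Phi phi y <= b * (y + lam - 1) by rewrite Py ler_wpM2r.
  have [yzE|yzN] := eqVneq y z; first by rewrite -yzE.
  have := Phi_tangent b0 y01; rewrite Fb => /(_ yzN); lra.
have Ep := E_put k0; rewrite Fk in Ep.
have kPz : b^-1 * Phi phi z <= z + lam - 1 by rewrite ler_pdivrMl.
have p0 : 0 < z - b^-1 * Phi phi z by rewrite subr_gt0 ltr_pdivrMl.
rewrite -two_level0.
have -> : (1 - z) / lam = 0 + (1 - 0) * ((1 - z) / lam) by ring.
apply: (@two_level_optimal b^-1 ((1 - lam) / (z - b^-1 * Phi phi z))) => //.
- apply/andP; split; first by rewrite divr_ge0 ?(ltW p0)// subr_ge0.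
  by rewrite ler_pdivrMr//; lra.
- by rewrite Ep divfK// gt_eqF.
- by rewrite lexx ler01.
- by rewrite subr0 mul1r.
- by rewrite /dual_value E_call// Fk Pz; field; rewrite !gt_eqF.
Qed.

(** The maximum [C_lambda] itself is the multiplier, with [th = 1]:
    [E[(1 - C phi)^+] = y_lambda - C Phi y_lambda = 1 - lam]. *)
Lemma optimal_high : v_lambda phi lam < v ->
  NP_unique_solution phi lam v (two_level (beta_star phi lam v) y) /\
  min_risk phi lam v = (1 - C_lambda phi lam * (1 - v) / lam)%:E.
Proof.
move: lam_gt0 lam_le1 v_ge0 v_le1 => l0 l1 v0 v1; rewrite /v_lambda -/y => vl.
have lt1 : lam < 1.
  case: lam_cases => // le1; move: vl.
  by rewrite /y (y_lambda1 phi_gt0 phi_mean cdf_cont cdf_incr l0 l1 le1) Phi0; lra.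
have [+ C0 yF yC _] := is_max_spec phi_gt0 phi_mean cdf_cont cdf_incr l0 l1
  (y_lambdaP phi_gt0 phi_mean cdf_cont cdf_incr l0 lt1).
rewrite -/y -/(C_lambda phi lam) in C0 yF yC * => /andP[ly y1].
have y0 : 0 < y by lra.
have y01 : 0 <= y <= 1 by rewrite (ltW y0).
have Py : 0 < Phi phi y by have := Phi_lt (lexx 0) y0 y1; rewrite Phi0.
set C := C_lambda phi lam in C0 yF yC *.
have bE : 1 - beta_star phi lam v = (1 - v) / Phi phi y.
  by rewrite /beta_star -/y; field; rewrite gt_eqF.
have valE : 1 - C * (1 - v) / lam = beta_star phi lam v +
    (1 - beta_star phi lam v) * ((1 - y) / lam).
  rewrite bE /beta_star /C /C_lambda -/y; field.
  by rewrite !gt_eqF.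
rewrite valE; apply: (@two_level_optimal C 1) => //.
- by rewrite ler01 lexx.
- by rewrite E_put// -yF -yC; ring.
- rewrite /beta_star -/y; apply/andP; split.
    by rewrite divr_ge0 ?(ltW Py)//; lra.
  by rewrite ler_pdivrMr//; lra.
- by rewrite bE divfK// gt_eqF.
- rewrite -valE /dual_value E_call// -yF -yC; field.
  by rewrite gt_eqF.
Qed.

End solution.

Theorem corollary4p5 (d : measure_display) (T : measurableType d)
    (R : realType) (P : probability T R) (phi : {RV P >-> R}) (lam v : R)
    (P_atomless : atomless P)
    (phi_gt0 : {ae P, forall w, 0 < phi w})
    (phi_mean : ('E_P[phi] = 1)%E)
    (cdf_cont : continuous (cdf phi))
    (cdf_incr : forall x y : R, 0 < x -> x < y -> (cdf phi y < 1)%E ->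
       (cdf phi x < cdf phi y)%E)
    (lam_gt0 : 0 < lam) (lam_le1 : lam <= 1)
    (v_ge0 : 0 <= v) (v_le1 : v <= 1) :
  exists Xstar : T -> R,
    [/\ NP_unique_solution phi lam v Xstar,
        v <= v_lambda phi lam ->
          Xstar = indic_ge phi (quantile phi (z_of phi v)),
        v_lambda phi lam < v ->
          Xstar = (fun w => beta_star phi lam v + (1 - beta_star phi lam v)
                     * indic_ge phi (quantile phi (y_lambda phi lam)) w)
      & min_risk phi lam v =
          (if v <= v_lambda phi lam then (1 - z_of phi v) / lam
           else 1 - C_lambda phi lam * (1 - v) / lam)%:E].
Proof.
have [vl|vl] := leP v (v_lambda phi lam).
  have [sol risk] := optimal_low phi_gt0 phi_mean cdf_cont cdf_incr
    lam_gt0 lam_le1 v_ge0 v_le1 vl.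
  by exists (indic_ge phi (quantile phi (z_of phi v))).
have [sol risk] := optimal_high phi_gt0 phi_mean cdf_cont cdf_incr
  lam_gt0 lam_le1 v_ge0 v_le1 vl.
by exists (two_level phi (beta_star phi lam v) (y_lambda phi lam)).
Qed.
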